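(* Let $(A,\mathfrak m)$ be a Gorenstein local ring of dimension $d$ and let $I$ be a proper ideal in $A$ with grade $g=\mu(I)-2$. Assume $A/I$ is Cohen-Macaulay. Then $\operatorname{depth}H_1(I)\ge d-g-2$.
   Context: $\mu(I)$ is the minimal number of generators of $I$; $\operatorname{grade}(I)$ is the length of a maximal $A$-regular sequence in $I$. $H_1(I)$ is the first Koszul homology module (coefficients in $A$) of a minimal generating set of $I$ (independent, up to isomorphism, of the choice). *)

(* Defs.v *)
From HB Require Import structures.
From mathcomp Require Import all_boot all_algebra.
From mathcomp Require Import boolp.

Set Implicit Arguments.
Unset Strict Implicit.
Unset Printing Implicit Defensive.

Import GRing.Theory.
Local Open Scope ring_scope.
Local Open Scope quotient_scope.

(* Ideals are mathcomp's [idealr] (proper ideals as boolean predicates) and, when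
   the unit ideal must be allowed, submodules [submodClosed R^o].  Booleans lose
   no generality: [boolp] makes every proposition decidable. *)

(* u \in (s_0, ..., s_(k-1)) M *)
Definition in_span (R : comNzRingType) (M : lmodType R) (s : seq R) (u : M) :
    Prop :=
  exists c : 'I_(size s) -> M, u = \sum_(i < size s) s`_i *: c i.

Definition generates (R : comNzRingType) (s : seq R) (J : {pred R}) : Prop :=
  forall a : R, a \in J <-> in_span s (a : R^o).

(* mu(J) = n *)
Definition min_num_generators (R : comNzRingType) (J : {pred R}) (n : nat) :
    Prop :=
  (exists2 s : seq R, generates s J & size s = n) /\
  (forall s : seq R, generates s J -> (n <= size s)%N).

Definition noetherian (R : comNzRingType) : Prop :=
  forall J : submodClosed R^o, exists s : seq R, generates s J.

Definition maximal_ideal (R : comNzRingType) (m : idealr R) : Prop :=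
  forall J : idealr R, {subset m <= J} -> {subset J <= m}.

Definition local_ring (R : comNzRingType) (m : idealr R) : Prop :=
  maximal_ideal m /\ (forall n : idealr R, maximal_ideal n -> n =i m).

Definition prime_chain (R : comNzRingType) (n : nat)
    (p : nat -> prime_idealr R) : Prop :=
  forall i, (i < n)%N ->
    {subset p i <= p i.+1} /\ exists2 x, x \in p i.+1 & x \notin p i.

Definition krull_dim (R : comNzRingType) (d : nat) : Prop :=
  (exists p : nat -> prime_idealr R, prime_chain d p) /\
  (forall n (p : nat -> prime_idealr R), prime_chain n p -> (n <= d)%N).

Definition regular_sequence (R : comNzRingType) (M : lmodType R) (s : seq R) :
    Prop :=
  (forall (i : nat) (u : M), (i < size s)%N ->
     in_span (take i s) (s`_i *: u) -> in_span (take i s) u) /\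
  (exists u : M, ~ in_span s u).

Definition maximal_regular_sequence (R : comNzRingType) (J : {pred R})
    (M : lmodType R) (s : seq R) : Prop :=
  [/\ {subset s <= J}, regular_sequence M s
    & forall x, x \in J -> ~ regular_sequence M (rcons s x)].

Definition has_grade (R : comNzRingType) (J : {pred R}) (M : lmodType R)
    (n : nat) : Prop :=
  exists2 s : seq R, maximal_regular_sequence J M s & size s = n.

(* The grade is infinite when JM = M, in particular when M = 0. *)
Definition grade_at_least (R : comNzRingType) (J : {pred R}) (M : lmodType R)
    (k : nat) : Prop :=
  (forall u : M, exists2 s : seq R, {subset s <= J} & in_span s u) \/
  (exists2 n, has_grade J M n & (k <= n)%N).

(* The depth of a module over a local ring is the grade of the maximal ideal. *)
Definition has_depth (R : comNzRingType) (m : idealr R) (M : lmodType R)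
    (n : nat) : Prop :=
  has_grade m M n.

Definition depth_at_least (R : comNzRingType) (m : idealr R) (M : lmodType R)
    (k : nat) : Prop :=
  grade_at_least m M k.

Definition cohen_macaulay_local (R : comNzRingType) : Prop :=
  exists n : idealr R, [/\ noetherian R, local_ring n
    & exists2 d, krull_dim R d & has_depth n R^o d].

Definition injective_module (R : comNzRingType) (E : lmodType R) : Prop :=
  forall (M N : lmodType R) (i : {linear M -> N}) (f : {linear M -> E}),
    injective i -> exists g : {linear N -> E}, forall u, g (i u) = f u.

Definition exact_at (R : comNzRingType) (M N P : lmodType R)
    (f : {linear M -> N}) (g : {linear N -> P}) : Prop :=
  forall v : N, g v = 0 <-> exists u, v = f u.

(* 0 -> M -> E 0 -> ... -> E n -> 0 *)
Definition finite_injective_dim (R : comNzRingType) (M : lmodType R) : Prop :=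
  exists (n : nat) (E : nat -> lmodType R)
      (d : forall i, {linear E i -> E i.+1}) (e : {linear M -> E 0}),
    [/\ forall i, injective_module (E i),
        forall i, (n < i)%N -> forall u : E i, u = 0,
        injective e,
        exact_at e (d 0)
      & forall i, exact_at (d i) (d i.+1)].

Definition gorenstein_local (R : comNzRingType) (m : idealr R) : Prop :=
  [/\ noetherian R, local_ring m & finite_injective_dim R^o].

Section Homology.
Variables (R : comNzRingType) (U V W : lmodType R).
Variables (f : {linear U -> V}) (g : {linear V -> W}).

Definition in_ker : V -> bool := fun v => g v == 0.

Fact in_ker_submod_closed : submod_closed in_ker.
Proof.
split=> [|a u v]; first by rewrite unfold_in /in_ker linear0.
rewrite !unfold_in /in_ker => /eqP gu /eqP gv.
by rewrite linearP gu gv scaler0 addr0.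
Qed.
HB.instance Definition _ :=
  GRing.isSubmodClosed.Build R V in_ker in_ker_submod_closed.

Record cycle := Cycle { cycle_val : V; _ : cycle_val \in in_ker }.
HB.instance Definition _ := [isSub for cycle_val].
HB.instance Definition _ := [Choice of cycle by <:].
HB.instance Definition _ := [SubChoice_isSubLmodule of cycle by <:].

Definition in_im : cycle -> bool := fun z => `[< exists u, cycle_val z = f u >].

Fact in_im_submod_closed : submod_closed in_im.
Proof.
split=> [|a y z].
  by apply/asboolP; exists 0; rewrite linear0 -[LHS]/(val (0 : cycle)) raddf0.
move=> /asboolP[u yu] /asboolP[v zv]; apply/asboolP; exists (a *: u + v).
by rewrite linearP -yu -zv -[LHS]/(val (a *: y + z)) linearP.
Qed.
HB.instance Definition _ :=
  GRing.isSubmodClosed.Build R cycle in_im in_im_submod_closed.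

Definition boundaries : zmodClosed cycle := GRing.ZmodClosed.clone cycle in_im _.

(* Ker g / Im f; the intended use is g \o f = 0, otherwise Im f is replaced by
   its intersection with Ker g. *)
Definition homology := Quotient.quot boundaries.
HB.instance Definition _ := GRing.Zmodule.on homology.

Definition homology_scale (a : R) (h : homology) : homology :=
  \pi_homology (a *: repr h).

Fact pi_homology_scale a z :
  homology_scale a (\pi_homology z) = \pi_homology (a *: z).
Proof.
apply/eqP; rewrite /homology_scale -Quotient.idealrBE -scalerBr.
by apply: rpredZ; rewrite [_ \in _](Quotient.idealrBE boundaries) reprK.
Qed.

Fact homology_scaleA a b h :
  homology_scale a (homology_scale b h) = homology_scale (a * b) h.
Proof.
by rewrite -[h]reprK (pi_homology_scale b) !pi_homology_scale scalerA.
Qed.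

Fact homology_scale1 : left_id 1 homology_scale.
Proof. by move=> h; rewrite -[h]reprK pi_homology_scale scale1r. Qed.

Fact homology_scaleDr : right_distributive homology_scale +%R.
Proof.
move=> a h k; rewrite -[h]reprK -[k]reprK.
by rewrite -raddfD !pi_homology_scale scalerDr raddfD.
Qed.

Fact homology_scaleDl h : {morph homology_scale^~ h : a b / a + b}.
Proof.
by move=> a b; rewrite -[h]reprK !pi_homology_scale scalerDl raddfD.
Qed.

HB.instance Definition _ := GRing.Zmodule_isLmodule.Build R homology
  homology_scaleA homology_scale1 homology_scaleDr homology_scaleDl.

End Homology.

Section Koszul.
Variables (R : comNzRingType) (x : seq R).
Local Notation n := (size x).

Definition koszul_index (p : nat) := {S : {set 'I_n} | #|S| == p}.

(* The degree p part of the Koszul complex of x: the basis vector indexed by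
   S = {i_1 < ... < i_p} stands for e_(i_1) /\ ... /\ e_(i_p). *)
Definition koszul (p : nat) := {ffun koszul_index p -> R^o}.
HB.instance Definition _ p := GRing.Lmodule.on (koszul p).

(* d e_S = \sum_(j in S) (-1)^#{i in S | i < j} x_j e_(S \ j) *)
Definition koszul_diff_fun (p : nat) (c : koszul p.+1) : koszul p :=
  [ffun T : koszul_index p =>
    \sum_(S : koszul_index p.+1) \sum_(j in val S | val S :\ j == val T)
      ((-1) ^+ #|[set i in val S | (i < j)%N]| * x`_j) *: c S].

Fact koszul_diff_is_linear p : linear (@koszul_diff_fun p).
Proof.
move=> a c c'; apply/ffunP => T; rewrite !ffunE scaler_sumr -big_split.
apply: eq_bigr => S _; rewrite scaler_sumr -big_split.
apply: eq_bigr => j _ /=; rewrite !ffunE scalerDr !scalerA.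
by congr (_ *: _ + _); rewrite mulrC.
Qed.
HB.instance Definition _ p := GRing.isLinear.Build R (koszul p.+1) (koszul p) _
  (@koszul_diff_fun p) (@koszul_diff_is_linear p).

Definition koszul_diff (p : nat) : {linear koszul p.+1 -> koszul p} :=
  @koszul_diff_fun p.

Definition koszul_H1 : lmodType R := homology (koszul_diff 1) (koszul_diff 0).

End Koszul.

(* Main.v *)
(* Let t = depth A, let y be a maximal regular sequence in I, of length g, and
   let x generate I, with g + 2 elements.

   Finite injective dimension enters only through Ext: Ext^i(A/K, A) vanishes
   for i > t - depth (A/K).  It is computed on K-torsion elements of an injective
   resolution of A, and the vanishing follows from Nakayama's lemma and noetherian
   induction on K.  Localizing the same argument at the primes of a chain gives
   dim A <= t; since I lies in an associated prime of A/(y), also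
   depth (A/I) = dim (A/I) >= t - g.

   For z regular on A/(y), the vanishing of Ext^(g+1)(A/I, A) says that
   (y, z) : I = (y : I) + (z).  Multiplying by the elements of y is null-homotopic
   on the Koszul complex K of x, so descending along y turns this identity, which
   concerns the top of K (x; A/(y)), into the surjectivity of
   H_2(x; A) -> H_2(x; A/z).  Hence z is regular on H_1(x; A); if z is also regular
   on A/I, then H_1(x; A)/z embeds in H_1(x; A/z), and one iterates with t - g
   elements z, which exceeds the required depth by 2. *)
Require Import Defs.
From HB Require Import structures.
From mathcomp Require Import all_boot all_algebra.
From mathcomp Require Import boolp ring zify.

Set Implicit Arguments.
Unset Strict Implicit.
Unset Printing Implicit Defensive.

Import GRing.Theory.
Local Open Scope ring_scope.
Local Open Scope quotient_scope.

(** * Submodules and ideals as predicates *)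

(** The number g + 2 of generators is a degree count. Top cycles of K (x; A/(y)) sit in degree g + 2
    and are the elements that I kills modulo (y); each of the g elements of y costs one degree, so
    the colon identity arrives exactly at H_2. The exact sequence H_2 (x; A) -> H_2 (x; A/z) -> H_1
    (x; A) -> H_1 (x; A), whose last map is multiplication by z, turns surjectivity into regularity.

    Apart from A/I in the statement, no quotient ring, localization or Ext module is formed. A/J is
    replaced by congruences modulo J, localization at q by multipliers outside q, and an Ext class
    by a torsion cocycle of the resolution. The price is that finite generation of Ext, which
    Nakayama's lemma needs, must be shown by hand, since the injective modules themselves are not
    finitely generated.

    Iterating means working modulo the elements z already chosen. Hence each new z has to be regular
    on many quotients at once, which is why avoidance is stated for a family of ideals and why depth
    is tracked for all prefixes of y. *)

Section Submodules.
Variable A : comNzRingType.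
Implicit Types V : lmodType A.

Definition submod V (L : V -> Prop) : Prop :=
  L 0 /\ forall a u v, L u -> L v -> L (a *: u + v).

Section SubmodTheory.
Variables (V : lmodType A) (L : V -> Prop).
Hypothesis Lsub : submod L.

Lemma submod0 : L 0. Proof. exact: Lsub.1. Qed.

Lemma submodZ a u : L u -> L (a *: u).
Proof. by move=> Lu; rewrite -[_ *: _]addr0; apply: Lsub.2 => //; apply: Lsub.1. Qed.

Lemma submodD u v : L u -> L v -> L (u + v).
Proof. by move=> Lu Lv; rewrite -[u]scale1r; apply: Lsub.2. Qed.

Lemma submodN u : L u -> L (- u).
Proof. by move=> Lu; rewrite -scaleN1r; apply: submodZ. Qed.

Lemma submodB u v : L u -> L v -> L (u - v).
Proof. by move=> Lu Lv; apply: submodD => //; apply: submodN. Qed.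

Lemma submod_subl u v : L (u - v) -> L v -> L u.
Proof. by move=> Luv Lv; rewrite -[u](subrK v); apply: submodD. Qed.

Lemma submod_subr u v : L (u - v) -> L u -> L v.
Proof. by move=> Luv Lu; rewrite -[v](subKr u); apply: submodB. Qed.

Lemma submod_sum I (r : seq I) (P : pred I) (F : I -> V) :
  (forall i, P i -> L (F i)) -> L (\sum_(i <- r | P i) F i).
Proof. by move=> LF; elim/big_ind: _ => //; [apply: submod0 | apply: submodD]. Qed.

End SubmodTheory.

Section Span.
Variable V : lmodType A.
Implicit Types (s : seq A) (u v : V).

Lemma submod_span s : submod (@in_span A V s).
Proof.
split=> [|a u v [c ->] [c' ->]].
  by exists (fun=> 0); rewrite big1 // => i _; rewrite scaler0.
exists (fun i => a *: c i + c' i); rewrite scaler_sumr -big_split.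
by apply: eq_bigr => i _; rewrite scalerDr !scalerA mulrC.
Qed.

Lemma in_span_mem s x v : x \in s -> in_span s (x *: v).
Proof.
move=> xs; have ix : (index x s < size s)%N by rewrite index_mem.
exists (fun i => if i == Ordinal ix then v else 0).
rewrite (bigD1 (Ordinal ix)) //= eqxx nth_index // big1 ?addr0 // => i /negPf->.
by rewrite scaler0.
Qed.

Lemma in_span_min s (L : V -> Prop) u :
  submod L -> (forall x v, x \in s -> L (x *: v)) -> in_span s u -> L u.
Proof.
move=> Lsub Ls [c ->]; apply: submod_sum => // i _.
by apply: Ls; apply: mem_nth.
Qed.

Lemma in_span_sub s t u : {subset s <= t} -> in_span s u -> in_span t u.
Proof.
move=> st; apply: in_span_min; first exact: submod_span.
by move=> x v /st; apply: in_span_mem.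
Qed.

Lemma in_span_nil u : in_span [::] u -> u = 0.
Proof. by case=> c ->; rewrite big_ord0. Qed.

Lemma in_span_rcons s x u :
  in_span (rcons s x) u <-> exists v, in_span s (u - x *: v).
Proof.
split=> [|[v uv]]; last first.
  apply: (submod_subl (submod_span _)).
    by apply: in_span_sub uv => y; rewrite mem_rcons inE orbC => ->.
  by apply: in_span_mem; rewrite mem_rcons mem_head.
apply: (in_span_min (L := fun u => exists v, in_span s (u - x *: v))) => [|y v].
  split=> [|a w1 w2 [v1 h1] [v2 h2]].
    by exists 0; rewrite scaler0 subr0; apply: submod0 (submod_span _).
  exists (a *: v1 + v2).
  rewrite scalerDr opprD addrACA scalerA [x * a]mulrC -scalerA -scalerBr.
  exact: (submod_span s).2.
rewrite mem_rcons inE => /predU1P[->|ys].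
  by exists v; rewrite subrr; apply: submod0 (submod_span _).
by exists 0; rewrite scaler0 subr0; apply: in_span_mem.
Qed.

End Span.

Definition ideal (J : A -> Prop) : Prop :=
  J 0 /\ forall a u v, J u -> J v -> J (a * u + v).
Definition subideal (J K : A -> Prop) : Prop := forall a, J a -> K a.
(* The ideals J + (x) and J : x. *)
Definition adj (J : A -> Prop) (x : A) : A -> Prop :=
  fun a => exists r, J (a - r * x).
Definition colon (J : A -> Prop) (x : A) : A -> Prop := fun a => J (a * x).
Definition regular (J : A -> Prop) (x : A) : Prop :=
  forall u, J (x * u) -> J u.
Definition prime_pred (q : A -> Prop) : Prop :=
  [/\ ideal q, ~ q 1 & forall a b, q (a * b) -> q a \/ q b].

(** Depth of A/J with respect to m, without forming the quotient. Properness of the final ideal is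
    not demanded, so the unit ideal has infinite depth. *)
Fixpoint depth_ge (m J : A -> Prop) (k : nat) : Prop :=
  if k is k'.+1 then exists x, [/\ m x, regular J x & depth_ge m (adj J x) k']
  else True.

Section IdealTheory.
Variable J : A -> Prop.
Hypothesis Jid : ideal J.

Let Jsub : submod (V := A^o) J. Proof. exact: Jid. Qed.

Lemma ideal0 : J 0. Proof. exact: (submod0 Jsub). Qed.
Lemma idealMl a u : J u -> J (a * u). Proof. exact: (submodZ Jsub). Qed.
Lemma idealM a u : J u -> J (u * a). Proof. by rewrite mulrC; apply: idealMl. Qed.
Lemma idealD u v : J u -> J v -> J (u + v). Proof. exact: (submodD Jsub). Qed.
Lemma idealN u : J u -> J (- u). Proof. exact: (submodN Jsub). Qed.
Lemma idealB u v : J u -> J v -> J (u - v). Proof. exact: (submodB Jsub). Qed.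
Lemma ideal_subl u v : J (u - v) -> J v -> J u. Proof. exact: (submod_subl Jsub). Qed.
Lemma ideal_subr u v : J (u - v) -> J u -> J v. Proof. exact: (submod_subr Jsub). Qed.

Lemma ideal_adj x : ideal (adj J x).
Proof.
split=> [|a u v [r ru] [r' rv]]; first by exists 0; rewrite mul0r subr0; apply: ideal0.
exists (a * r + r'); have -> : a * u + v - (a * r + r') * x =
  a * (u - r * x) + (v - r' * x) by ring.
by apply: idealD => //; apply: idealMl.
Qed.

Lemma subideal_adj x : subideal J (adj J x).
Proof. by move=> a Ja; exists 0; rewrite mul0r subr0. Qed.

Lemma mem_adj x : adj J x x.
Proof. by exists 1; rewrite mul1r subrr; apply: ideal0. Qed.

Lemma adj_min K x : ideal K -> subideal J K -> K x -> subideal (adj J x) K.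
Proof.
move=> [K0 KD] JK Kx a [r /JK h]; rewrite -[a](subrK (r * x)) addrC.
by apply: (KD r x).
Qed.

Lemma ideal_colon a : ideal (colon J a).
Proof.
split=> [|b u v hu hv]; first by rewrite /colon mul0r; apply: ideal0.
rewrite /colon mulrDl -mulrA; apply: idealD => //; exact: idealMl.
Qed.

Lemma subideal_colon a : subideal J (colon J a).
Proof. by move=> u Ju; apply: idealM. Qed.

End IdealTheory.

Lemma pred_ext T (J K : T -> Prop) : (forall a, J a <-> K a) -> J = K.
Proof. by move=> JK; apply/funext => a; apply/propext; apply: JK. Qed.

Definition idl (s : seq A) : A -> Prop := fun a => in_span s (a : A^o).

Lemma ideal_span (s : seq A) : ideal (idl s).
Proof. exact: (submod_span A^o s). Qed.

Lemma mem_idl (s : seq A) x : x \in s -> idl s x.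
Proof. by move=> xs; rewrite -[x]mulr1; apply: (@in_span_mem A^o). Qed.

Lemma idl_min (s : seq A) (J : A -> Prop) :
  ideal J -> (forall x, x \in s -> J x) -> subideal (idl s) J.
Proof.
move=> Jid Js a; apply: (in_span_min (L := J : A^o -> Prop)) => // x v xs.
by rewrite -[_ *: _]/(x * v); apply: idealM => //; apply: Js.
Qed.

Lemma idl_sub (s t : seq A) : {subset s <= t} -> subideal (idl s) (idl t).
Proof. by move=> st; apply: idl_min (ideal_span t) _ => x /st; apply: mem_idl. Qed.

Lemma idl_rcons (s : seq A) x : idl (rcons s x) = adj (idl s) x.
Proof.
apply: pred_ext => a; rewrite /idl in_span_rcons.
by split=> -[r h]; exists r; move: h; rewrite /idl -[x *: _]/(x * r) mulrC.
Qed.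

End Submodules.

(** * Noetherian rings: finite generation and induction *)

Section Noetherian.
Variable A : comNzRingType.
Hypothesis noethA : noetherian A.

Section ClosedOfIdeal.
Variable J : A -> Prop.
Hypothesis Jid : ideal J.
Definition ideal_pred : A^o -> bool := fun a => `[< J a >].
Fact ideal_pred_closed : submod_closed ideal_pred.
Proof.
split=> [|a u v /asboolP Ju /asboolP Jv]; apply/asboolP; first exact: Jid.1.
exact: Jid.2.
Qed.
End ClosedOfIdeal.

Lemma noetherian_fg (J : A -> Prop) : ideal J ->
  exists s : seq A, forall a, J a <-> idl s a.
Proof.
move=> Jid.
pose M := GRing.isSubmodClosed.Build A A^o (ideal_pred J) (ideal_pred_closed Jid).
pose N : submodClosed A^o := HB.pack (ideal_pred J) M.
have [s sN] := noethA N; exists s => a.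
rewrite /idl -sN; split=> [Ja|]; first exact/asboolP.
by move/asboolP.
Qed.

(** The generators are taken from [U] itself, not merely from the ideal that it spans. *)
Lemma noetherian_fg_sub (U : A -> Prop) :
  exists2 s : seq A, forall x, x \in s -> U x & forall u, U u -> idl s u.
Proof.
pose J (a : A) := exists2 s : seq A, forall x, x \in s -> U x & idl s a.
have Jid : ideal J.
  split=> [|a u v [s sU su] [t tU tv]].
    by exists [::] => [x|]; [rewrite in_nil | apply: (ideal0 (ideal_span _))].
  exists (s ++ t) => [x|]; first by rewrite mem_cat => /orP[/sU|/tU].
  by apply: (ideal_span _).2; [apply: idl_sub su | apply: idl_sub tv] => x xs;
    rewrite mem_cat xs ?orbT.
have [t tJ] := noetherian_fg Jid.
have [s sU st] : exists2 s : seq A, forall x, x \in s -> U x &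
    forall x, x \in t -> idl s x.
  have: forall x, x \in t -> J x by move=> x xt; apply/tJ; apply: mem_idl.
  elim: t {tJ} => [|x t IH] Jt; first by exists [::].
  have [s sU st] := IH (fun y yt => Jt y (@mem_behead _ (x :: t) y yt)).
  have [r rU rx] := Jt x (mem_head _ _).
  exists (r ++ s) => [y|y]; first by rewrite mem_cat => /orP[/rU|/sU].
  rewrite inE => /predU1P[->|/st ys].
    by apply: idl_sub rx => z zr; rewrite mem_cat zr.
  by apply: idl_sub ys => z zr; rewrite mem_cat zr orbT.
exists s => // u Uu; have /tJ: J u.
  by exists [:: u]; [move=> x; rewrite inE => /eqP-> | apply: mem_idl; apply: mem_head].
by apply: idl_min => //; apply: ideal_span.
Qed.

Lemma noetherian_ind (P : (A -> Prop) -> Prop) :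
  (forall J, ideal J ->
     (forall K a, ideal K -> subideal J K -> K a -> ~ J a -> P K) -> P J) ->
  forall J, ideal J -> P J.
Proof.
move=> step J0 J0id; apply: contrapT => nP.
pose T := {J : A -> Prop | ideal J /\ ~ P J}.
(* A failure of [P] at J propagates to a strictly larger ideal; choosing repeatedly gives a strictly
   increasing chain, whose union is finitely generated, a contradiction. *)
have next (J : T) : exists K : T,
    subideal (sval J) (sval K) /\ exists2 a, sval K a & ~ sval J a.
  case: J => J [Jid nPJ] /=; apply: contrapT => nK; apply: nPJ.
  apply: step => // K a Kid JK Ka nJa.
  apply: contrapT => nPK; apply: nK; exists (exist _ K (conj Kid nPK)).
  by split=> //; exists a.
pose f J := sval (cid (next J)).
pose c n := sval (iter n f (exist _ J0 (conj J0id nP))).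
have cS n : subideal (c n) (c n.+1).
  by rewrite /c iterS /f; case: cid => K [].
have cle n k : subideal (c n) (c (n + k)%N).
  by elim: k => [|k IH] a; rewrite ?addn0 // addnS => /IH/cS.
have cle2 n k : (n <= k)%N -> subideal (c n) (c k).
  by move=> /subnKC <-; apply: cle.
have cid n : ideal (c n) by rewrite /c; case: (iter _ _ _) => ? [].
have Uid : ideal (fun a => exists n, c n a).
  split=> [|a u v [n cu] [k cv]]; first by exists 0%N; apply: (ideal0 (cid _)).
  exists (maxn n k); apply: (cid _).2; [apply: cle2 cu | apply: cle2 cv].
    exact: leq_maxl.
  exact: leq_maxr.
have [s sU] := noetherian_fg Uid.
have [n cs] : exists n, forall x, x \in s -> c n x.
  have: forall x, x \in s -> exists n, c n x by move=> x xs; apply/sU/mem_idl.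
  elim: s {sU} => [|x s IH] Us; first by exists 0%N.
  have [n cs] := IH (fun y yt => Us y (@mem_behead _ (x :: s) y yt)).
  have [k ck] := Us x (mem_head _ _).
  exists (maxn n k) => y; rewrite inE => /predU1P[->|/cs].
    by apply: cle2 ck; apply: leq_maxr.
  by apply: cle2; apply: leq_maxl.
have: exists2 a, c n.+1 a & ~ c n a.
  by rewrite /c iterS /f; case: boolp.cid => K [].
case=> a ca; apply; apply: (idl_min (cid n) cs).
by apply/sU; exists n.+1.
Qed.

(** Induction along a finite chain from S to J, one element of J at a time. It is used to carry a
    property of S up to J by means of 0 -> A/(K : a) -> A/K -> A/(K + (a)) -> 0. *)
Lemma adjoin_ind (S J : A -> Prop) (P : (A -> Prop) -> Prop) :
  ideal S -> ideal J -> subideal S J -> P S ->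
  (forall K a, ideal K -> subideal S K -> subideal K J -> J a -> P K -> P (adj K a)) ->
  P J.
Proof.
move=> Sid Jid SJ PS step; have [s sJ] := noetherian_fg Jid.
suff [K [Kid SK KJ PK sK]] : exists K,
    [/\ ideal K, subideal S K, subideal K J, P K & forall x, x \in s -> K x].
  have -> // : J = K.
  by apply: pred_ext => a; split=> [/sJ|]; [apply: idl_min | apply: KJ].
have: forall x, x \in s -> J x by move=> x /mem_idl/sJ.
elim: s {sJ} => [|x s IH] sJ; first by exists S; split=> // a; apply.
have [|K [Kid SK KJ PK sK]] := IH.
  by move=> y ys; apply: sJ; rewrite inE ys orbT.
have Jx := sJ x (mem_head _ _).
exists (adj K x); split; first exact: ideal_adj.
- by move=> a /SK; apply: subideal_adj.
- exact: adj_min.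
- exact: step.
- move=> y; rewrite inE => /predU1P[->|/sK]; [exact: mem_adj | exact: subideal_adj].
Qed.

(** Leading entries form an ideal, and the vectors with leading entry 0 form a submodule of a free
    module of smaller rank; generators of both are combined. *)
Lemma fg_row_submod k (L : 'rV[A]_k -> Prop) : submod L ->
  exists l (Q : 'M[A]_(l, k)), (forall i, L (row i Q)) /\
    (forall c, L c -> exists r : 'rV_l, c = r *m Q).
Proof.
elim: k L => [L Lsub|k IH].
  exists 0%N, 0; split=> [[]//|c _]; exists 0.
  by apply/rowP; case.
rewrite -[k.+1]/(1 + k)%N => L Lsub.
pose J a := exists c : 'rV[A]_k, L (row_mx (a%:M : 'rV_1) c).
have Jid : ideal J.
  split=> [|a u v [c hu] [c' hv]].
    by exists 0; rewrite raddf0 row_mx0; apply: Lsub.1.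
  exists (a *: c + c'); have -> : row_mx ((a * u + v)%:M : 'rV_1) (a *: c + c') =
    a *: row_mx (u%:M : 'rV_1) c + row_mx (v%:M : 'rV_1) c'.
    by rewrite scale_row_mx add_row_mx raddfD /= scale_scalar_mx.
  exact: Lsub.2.
have [s sJ] := noetherian_fg Jid.
have L0sub : submod (fun c : 'rV_k => L (row_mx (0 : 'rV_1) c)).
  split=> [|a u v hu hv]; first by rewrite row_mx0; apply: Lsub.1.
  have -> : row_mx (0 : 'rV_1) (a *: u + v) = a *: row_mx 0 u + row_mx 0 v.
    by rewrite scale_row_mx add_row_mx scaler0 addr0.
  exact: Lsub.2.
have [l [Q [QL Qgen]]] := IH _ L0sub.
have wP (i : 'I_(size s)) : exists c : 'rV[A]_k, L (row_mx ((s`_i)%:M : 'rV_1) c).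
  by apply/sJ/mem_idl/mem_nth.
pose w i := sval (cid (wP i)).
pose W : 'M[A]_(size s, 1 + k) := \matrix_i row_mx ((s`_i)%:M : 'rV_1) (w i).
exists (size s + l)%N, (col_mx W (row_mx (0 : 'cV_l) Q)); split=> [i|c Lc].
  rewrite -[i]splitK; case: (split i) => j /=.
    by rewrite rowKu rowK /w; case: cid.
  by rewrite rowKd row_row_mx row0; apply: QL.
have [f fE] : idl s (lsubmx c 0 0).
  apply/sJ; exists (rsubmx c).
  by rewrite -mx11_scalar hsubmxK.
pose r1 := \row_i f i : 'rV[A]_(size s).
have cW : lsubmx c = lsubmx (r1 *m W).
  apply/rowP => j; rewrite ord1 fE !mxE; apply: eq_bigr => i _.
  rewrite /W !mxE; case: splitP => // j1 _.
  by rewrite [j1]ord1 mxE -[_ *: _]/(_ * _) mulrC.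
have [|r2 r2E] := Qgen (rsubmx (c - r1 *m W)).
  have -> : 0 = lsubmx (c - r1 *m W) :> 'rV_1.
    by rewrite linearB /= cW subrr.
  rewrite hsubmxK; apply: submodB => //; rewrite mulmx_sum_row.
  apply: submod_sum => // i _; apply: submodZ => //.
  by rewrite rowK /w; case: cid.
exists (row_mx r1 r2); rewrite mul_row_col mul_mx_row -r2E mulmx0.
rewrite -[c in LHS](subrK (r1 *m W)) addrC; congr (_ + _).
rewrite -[LHS](@hsubmxK _ 1 1 k); congr row_mx.
by rewrite linearB /= cW subrr.
Qed.

End Noetherian.

(** * Injective modules and systems of linear equations *)

Section RowSpace.
Variables (A : comNzRingType) (k n : nat) (P : 'M[A]_(k, n)).

Definition in_rowspace : 'rV[A]_n -> bool := fun v => `[< exists c, v = c *m P >].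

Fact in_rowspace_closed : submod_closed in_rowspace.
Proof.
split=> [|a u v /asboolP[c ->] /asboolP[c' ->]]; apply/asboolP.
  by exists 0; rewrite mul0mx.
by exists (a *: c + c'); rewrite mulmxDl scalemxAl.
Qed.
HB.instance Definition _ :=
  GRing.isSubmodClosed.Build A 'rV[A]_n in_rowspace in_rowspace_closed.

(** Injectivity quantifies over module types, so the submodule spanned by the rows of [P] must
    become a type before a map can be extended from it. *)
Record rowspace := Rowspace { rowspace_val : 'rV[A]_n; _ : rowspace_val \in in_rowspace }.
HB.instance Definition _ := [isSub for rowspace_val].
HB.instance Definition _ := [Choice of rowspace by <:].
HB.instance Definition _ := [SubChoice_isSubLmodule of rowspace by <:].

Lemma rowspaceP (v : rowspace) : exists c, val v = c *m P.
Proof. by case: v => v /= /asboolP. Qed.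

End RowSpace.

Section Injective.
Variables (A : comNzRingType) (E : lmodType A).
Hypothesis injE : injective_module E.

(** Compatibility with the syzygies of the rows says that sending row i to [g i] is a well-defined
    map on the row space; the solution is read off an extension to the free module. *)
Lemma injective_solve k n (P : 'M[A]_(k, n)) (g : 'I_k -> E) :
  (forall c : 'rV_k, c *m P = 0 -> \sum_i c 0 i *: g i = 0) ->
  exists h : 'I_n -> E, forall i, \sum_j P i j *: h j = g i.
Proof.
move=> gP; pose ev (c : 'rV_k) := \sum_i c 0 i *: g i.
have ev_lin a c c' : ev (a *: c + c') = a *: ev c + ev c'.
  rewrite /ev scaler_sumr -big_split; apply: eq_bigr => i _.
  by rewrite !mxE scalerDl scalerA.
have ev_eq c c' : c *m P = c' *m P -> ev c = ev c'.
  move=> cc'; apply/eqP; rewrite -subr_eq0 addrC -scaleN1r -ev_lin.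
  by apply/eqP/gP; rewrite mulmxDl -scalemxAl cc' scaleN1r addNr.
pose phi (v : rowspace P) := ev (sval (cid (rowspaceP v))).
have phiE v c : val v = c *m P -> phi v = ev c.
  by rewrite /phi; case: cid => c' /= -> /ev_eq.
have phi_lin : linear phi.
  move=> a u v; have [c uc] := rowspaceP u; have [c' vc] := rowspaceP v.
  rewrite (phiE _ _ uc) (phiE _ _ vc) -ev_lin; apply: phiE.
  by rewrite linearP /= mulmxDl -scalemxAl -uc -vc.
pose phiL := GRing.isLinear.Build A (rowspace P) E _ phi phi_lin.
pose Phi : {linear rowspace P -> E} := HB.pack phi phiL.
have [G GP] := injE (i := (val : {linear rowspace P -> 'rV[A]_n})) Phi val_inj.
exists (fun j => G (delta_mx 0 j)) => i.
have mem_row : row i P \in in_rowspace P.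
  by apply/asboolP; exists (delta_mx 0 i); rewrite rowE.
transitivity (G (row i P)).
  rewrite [row i P]row_sum_delta linear_sum; apply: eq_bigr => j _.
  by rewrite linearZ mxE.
rewrite -[row i P]/(val (Rowspace mem_row)) GP.
transitivity (ev (delta_mx 0 i)); first by apply: phiE; rewrite -rowE.
rewrite /ev (bigD1 i) //= mxE !eqxx scale1r big1 ?addr0 // => j /negPf ji.
by rewrite mxE ji andbF scale0r.
Qed.

Definition kills (J : A -> Prop) (v : E) : Prop := forall a, J a -> a *: v = 0.

Hypothesis noethA : noetherian A.

(** Multiplication by a embeds A/(J : a) into A/J, so Hom (_, E) maps onto. Concretely, one solves
    the system a f' = f and s_i f' = 0 for generators s_i of J. *)
Lemma injective_divide J a f : ideal J -> kills (colon J a) f ->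
  exists2 f' : E, kills J f' & a *: f' = f.
Proof.
move=> Jid fJ; have [s sJ] := noetherian_fg noethA Jid.
pose P : 'cV[A]_(1 + size s) := col_mx a%:M (\col_i s`_i).
pose g (i : 'I_(1 + size s)) := if split i is inl _ then f else 0.
have [c cP|h hP] := injective_solve (P := P) (g := g).
  rewrite big_split_ord /= big_ord1 big1 ?addr0; last first.
    by move=> i _; rewrite /g; case: splitP => [[[]]// ? /= |? _]; rewrite ?scaler0.
  rewrite /g; case: splitP => [j _|//]; apply: fJ; apply/sJ.
  have: lsubmx c *m a%:M + rsubmx c *m (\col_i s`_i) = 0 :> 'M_1.
    by rewrite -mul_row_col hsubmxK.
  move=> /matrixP/(_ 0 0); rewrite mul_mx_scalar !mxE /colon => ca.
  have -> : c 0 (lshift (size s) 0) * a = - \sum_j rsubmx c 0 j * s`_j.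
    apply/eqP; rewrite -addr_eq0 mulrC; apply/eqP; rewrite -[RHS]ca.
    by congr (_ + _); apply: eq_bigr => l _; rewrite [(\col_i _) _ _]mxE.
  apply: (idealN (ideal_span s)); exists (fun l => rsubmx c 0 l).
  by apply: eq_bigr => l _; rewrite mulrC.
exists (h 0).
  move=> r /sJ[c ->]; rewrite scaler_suml big1 // => i _.
  have := hP (rshift 1 i); rewrite big_ord1 col_mxEd mxE /g.
  case: splitP => [[[|?] ?] //|? _ e].
  by rewrite -[_ *: c i]/(_ * c i) mulrC -scalerA e scaler0.
have := hP (lshift (size s) 0); rewrite big_ord1 col_mxEu mxE eqxx /g.
by case: splitP.
Qed.

End Injective.

(** * Nakayama's lemma, localized at a prime by clearing denominators *)

Section Nakayama.
Variables (A : comNzRingType) (V : lmodType A) (L : V -> Prop) (q : A -> Prop).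
Hypotheses (Lsub : submod L) (qP : prime_pred q).

(** The last element is eliminated: its own coefficient [s0 - c0 N] lies outside q, hence acts as a
    unit at q, and substitution into the other relations keeps their coefficients in q. *)
Lemma nakayama N (w : nat -> V) :
  (forall a, (a < N)%N -> exists2 s, ~ q s & exists2 c : nat -> A,
     forall b, q (c b) & L (s *: w a - \sum_(b < N) c b *: w b)) ->
  exists2 s, ~ q s & forall a, (a < N)%N -> L (s *: w a).
Proof.
have [qid q1 qM] := qP.
elim: N => [|N IH] h; first by exists 1.
have [s0 s0q [c0 c0q L0]] := h N (ltnSn N).
have t0q : ~ q (s0 - c0 N) by move=> /(ideal_subl qid)/(_ (c0q N)).
have {}L0 : L ((s0 - c0 N) *: w N - \sum_(b < N) c0 b *: w b).
  by rewrite scalerBl addrAC; move: L0; rewrite big_ord_recr /= opprD addrA.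
have [|s sq Ls] := IH.
  move=> a aN; have [s1 s1q [c1 c1q L1]] := h a (leqW aN).
  exists ((s0 - c0 N) * s1) => [/qM[]//|].
  exists (fun b => (s0 - c0 N) * c1 b + c1 N * c0 b).
    by move=> b; apply: (idealD qid); apply: (idealMl qid).
  have := submodD Lsub (submodZ Lsub (s0 - c0 N) L1) (submodZ Lsub (c1 N) L0).
  move: (s0 - c0 N) => t; rewrite big_ord_recr /= => Lt.
  rewrite [X in L X](_ : _ = t *: (s1 *: w a - (\sum_(b < N) c1 b *: w b + c1 N *: w N)) +
    c1 N *: (t *: w N - \sum_(b < N) c0 b *: w b)) //.
  under eq_bigr do rewrite scalerDl -!scalerA.
  rewrite big_split /= -!scaler_sumr !scalerBr scalerDr !scalerA [c1 N * t]mulrC.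
  by rewrite !opprD !addrA subrK.
exists (s * (s0 - c0 N)) => [/qM[]//|a]; rewrite ltnS leq_eqVlt => /predU1P[->|aN].
  rewrite -scalerA; apply: (submod_subl Lsub (v := s *: \sum_(b < N) c0 b *: w b)).
    by rewrite -scalerBr; apply: submodZ.
  rewrite scaler_sumr; apply: submod_sum => // b _; rewrite scalerA mulrC -scalerA.
  by apply: submodZ => //; apply: Ls.
by rewrite mulrC -scalerA; apply: submodZ => //; apply: Ls.
Qed.

End Nakayama.

(** * Associated primes and depth *)

Section ZeroDivisors.
Variable A : comNzRingType.
Hypothesis noethA : noetherian A.

(** For such u, the ideal J : u is a maximal element among the annihilators of nonzero elements of
    A/J, hence an associated prime. *)
Definition max_annihilator (J : A -> Prop) (u : A) : Prop :=
  ~ J u /\ forall v, ~ J v -> subideal (colon J u) (colon J v) ->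
    subideal (colon J v) (colon J u).

Lemma max_annihilator_prime J u : ideal J -> max_annihilator J u ->
  prime_pred (colon J u).
Proof.
move=> Jid [Ju umax]; split; first exact: ideal_colon.
  by rewrite /colon mul1r.
move=> a b; rewrite /colon => abu.
have [|bu] := pselect (J (b * u)); [by right | left].
apply: (umax _ bu) => [c cu|]; last by rewrite /colon mulrA.
by rewrite /colon mulrCA; apply: idealMl.
Qed.

Lemma max_annihilator_ex J u : ideal J -> ~ J u ->
  exists2 v, max_annihilator J v & subideal (colon J u) (colon J v).
Proof.
move=> Jid Ju.
suff main K : ideal K -> forall u, colon J u = K -> ~ J u ->
    exists2 v, max_annihilator J v & subideal K (colon J v).
  exact: main (ideal_colon Jid u) u erefl Ju.
move: K; apply: (noetherian_ind noethA) => K Kid IH {}u uK {}Ju.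
have [[v [Jv uv [a va ua]]]|umax] := pselect (exists v, [/\ ~ J v,
    subideal (colon J u) (colon J v) & exists2 a, colon J v a & ~ colon J u a]).
  rewrite uK in uv ua.
  have [w wmax vw] := IH _ a (ideal_colon Jid v) uv va ua v erefl Jv.
  by exists w => // b /uv/vw.
exists u; last by rewrite uK.
split=> // v Jv uv a va; apply: contrapT => ua.
by apply: umax; exists v; split=> //; exists a.
Qed.

Lemma common_multiplier (J q : A -> Prop) (s : seq A) : ideal J -> prime_pred q ->
  (forall u, u \in s -> exists2 b, J (b * u) & ~ q b) ->
  exists2 b, ~ q b & forall u, u \in s -> J (b * u).
Proof.
move=> Jid [_ q1 qM]; elim: s => [|x s IH] h; first by exists 1.
have [|b bq bs] := IH; first by move=> u us; apply: h; rewrite inE us orbT.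
have [c cx cq] := h x (mem_head _ _).
exists (b * c) => [/qM[]//|u]; rewrite inE => /predU1P[->|/bs].
  by rewrite -mulrA; apply: idealMl.
by rewrite mulrAC; apply: idealM.
Qed.

(** Finitely many primes J : u cover the zero divisors on A/J. The u in [s] generate every
    maximal-annihilator element w; if no J : u lay in J : w, a common multiplier outside J : w would
    kill all of [s], hence w. *)
Lemma zero_divisor_primes J : ideal J -> exists2 s : seq A,
  forall u, u \in s -> max_annihilator J u &
  forall a v, J (a * v) -> ~ J v -> exists2 u, u \in s & colon J u a.
Proof.
move=> Jid; have [s smax sgen] := noetherian_fg_sub noethA (max_annihilator J).
exists s => // a v Jav /(max_annihilator_ex Jid)[w wmax vw].
have wP := max_annihilator_prime Jid wmax.
have [[u us uw]|no] := pselect (exists2 u, u \in s & subideal (colon J u) (colon J w)).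
  by by exists u => //; apply: ((smax _ us).2 _ wmax.1 uw); apply: vw.
have [u us|b bw bs] := common_multiplier (s := s) Jid wP.
  apply: contrapT => ub; apply: no; exists u => // b bu; apply: contrapT => bw.
  by apply: ub; exists b.
case: bw; rewrite /colon mulrC; apply: (idl_min (ideal_colon Jid b) _ (sgen _ wmax)).
  by move=> u /bs; rewrite /colon mulrC.
Qed.

Lemma prime_avoidance (T : eqType) (s : seq T) (p : T -> A -> Prop) (H : A -> Prop) :
  (forall i, i \in s -> prime_pred (p i)) -> ideal H ->
  (forall i, i \in s -> exists2 h, H h & ~ p i h) ->
  exists2 h, H h & forall i, i \in s -> ~ p i h.
Proof.
move=> + Hid; have [k] := ubnP (size s); elim: k s => // k IH [|x s] /=.
  by move=> _ _ _; exists 0 => //; apply: ideal0.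
rewrite ltnS => sk pP Hp.
have [xs ss] : x \in x :: s /\ {subset s <= x :: s}.
  by split=> [|i]; rewrite inE ?eqxx // => ->; rewrite orbT.
have [||h Hh hs] := IH s sk; [by move=> i /ss; apply: pP | by move=> i /ss; apply: Hp |].
have [pxh|pxh] := pselect (p x h); last first.
  by exists h => // i; rewrite inE => /predU1P[->|/hs].
(* If [p j] lies in [p x], avoiding [p x] suffices for both, and the list gets shorter. *)
have [[j js jx]|nosub] := pselect (exists2 j, j \in s & subideal (p j) (p x)).
  have jsub i : i \in x :: rem j s -> i \in x :: s.
    by rewrite !inE => /predU1P[->|/mem_rem->]; rewrite ?eqxx ?orbT.
  have [|||h' Hh' h's] := IH (x :: rem j s).
  - by rewrite /= size_rem //; case: (s) js sk.
  - by move=> i /jsub; apply: pP.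
  - by move=> i /jsub; apply: Hp.
  exists h' => // i; rewrite inE => /predU1P[->|si]; first by apply/h's/mem_head.
  have [->|ij] := eqVneq i j; first by move/jx; apply/h's/mem_head.
  apply: h's; rewrite inE; apply/orP; right.
  by move: si; rewrite (perm_mem (perm_to_rem js)) inE (negPf ij).
have [pxid px1 pxM] := pP x xs; have [h0 Hh0 pxh0] := Hp x xs.
have [w wx ws] : exists2 w, ~ p x w & forall j, j \in s -> p j w.
  suff main (t : seq T) : {subset t <= s} -> exists2 w, ~ p x w & forall j, j \in t -> p j w.
    exact: main.
  elim: t => [|j t IHt] ts; first by exists 1.
  have [|w wx wt] := IHt; first by move=> i it; apply: ts; rewrite inE it orbT.
  have [y yj yx] : exists2 y, p j y & ~ p x y.
    apply: contrapT => no; apply: nosub; exists j; first exact/ts/mem_head.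
    by move=> y yj; apply: contrapT => yx; apply: no; exists y.
  exists (w * y) => [/pxM[]//|i it].
  have [iid _ _] := pP i (ss i (ts i it)).
  move: it; rewrite inE => /predU1P[ij|/wt]; last exact: idealM.
  by rewrite ij; apply: idealMl => //; rewrite -ij.
(* [h] lies in [p x] and in no other [p i], while [h0 * w] lies in all the others and not in [p x];
   the sum avoids all. *)
exists (h + h0 * w); first by apply: idealD => //; apply: idealM.
move=> i; rewrite inE => /predU1P[-> e|si e].
  have /pxM[]// : p x (h0 * w) by rewrite -[h0 * w](addKr h) addrC; apply: idealB.
have [iid _ _] := pP i (ss i si); apply: (hs i si).
by rewrite -[h](addrK (h0 * w)); apply: idealB => //; apply: idealMl => //; apply: ws.
Qed.

(** Hom (A/m, A/J) = 0; over a noetherian ring this provides an element of m regular on A/J. *)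
Definition no_socle (m J : A -> Prop) : Prop :=
  forall u, ~ J u -> exists2 h, m h & ~ J (h * u).

(** An absent socle means that H lies in none of the finitely many primes covering the zero divisors
    on any A/(J i), so prime avoidance applies to all of them together. *)
Lemma regular_avoidance N (J : nat -> A -> Prop) (H : A -> Prop) :
  ideal H -> (forall i, (i < N)%N -> ideal (J i) /\ no_socle H (J i)) ->
  exists2 h, H h & forall i, (i < N)%N -> regular (J i) h.
Proof.
move=> Hid JP.
have sP i : exists s : seq A, (i < N)%N ->
    (forall u, u \in s -> max_annihilator (J i) u) /\
    forall a v, J i (a * v) -> ~ J i v -> exists2 u, u \in s & colon (J i) u a.
  have [iN|] := ltnP i N; last by exists [::].
  by have [s s1 s2] := zero_divisor_primes (JP i iN).1; exists s.
pose s i := sval (cid (sP i)).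
have sE i : (i < N)%N -> (forall u, u \in s i -> max_annihilator (J i) u) /\
    forall a v, J i (a * v) -> ~ J i v -> exists2 u, u \in s i & colon (J i) u a.
  by rewrite /s; case: cid.
pose t := [seq (i, u) | i <- iota 0 N, u <- s i].
have tP i u : (i, u) \in t -> (i < N)%N /\ max_annihilator (J i) u.
  move=> /allpairsPdep[i' [u' [+ us [-> ->]]]]; rewrite mem_iota add0n => iN.
  by split=> //; apply: (sE _ iN).1.
have [||h Hh ht] := prime_avoidance (s := t) (p := fun iu => colon (J iu.1) iu.2) _ Hid.
- by move=> [i u] /tP[iN umax]; apply: max_annihilator_prime umax; apply: (JP i iN).1.
- by move=> [i u] /tP[iN [Ju _]]; apply: (JP i iN).2.
exists h => // i iN v Jhv; apply: contrapT => Jv.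
have [u us] := (sE i iN).2 _ _ Jhv Jv.
apply: (ht (i, u)); apply/allpairsPdep; exists i, u; split=> //.
by rewrite mem_iota.
Qed.

Section Depth.
Variable m : A -> Prop.
Hypothesis mid : ideal m.
Implicit Types (J : A -> Prop) (x y z u : A).

Lemma regular_no_socle J x : m x -> regular J x -> no_socle m J.
Proof. by move=> mx xreg u Ju; exists x => // /xreg. Qed.

Lemma depth_ge_no_socle J k : depth_ge m J k.+1 -> no_socle m J.
Proof. by move=> [x [mx xreg _]]; apply: regular_no_socle mx xreg. Qed.

Lemma adjC J x y : ideal J -> adj (adj J x) y = adj (adj J y) x.
Proof.
move=> Jid; apply: pred_ext => a.
by split=> -[r [t h]]; exists t, r; rewrite addrAC.
Qed.

Lemma regular_swap J y z : ideal J -> regular J y -> regular J z ->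
  regular (adj J y) z -> regular (adj J z) y.
Proof.
move=> Jid yreg zreg zyreg u [v h].
have [|w hw] := zyreg v.
  exists u; rewrite -[_ - _]opprB; apply: idealN => //.
  by rewrite mulrC [z * v]mulrC.
exists w; apply: yreg.
have -> : y * (u - w * z) = y * u - v * z + z * (v - w * y) by ring.
by apply: idealD => //; apply: idealMl.
Qed.

(** Both socles compute Ext^1(A/m, A/J). The isomorphism sends u to v with y u = v x modulo J. *)
Lemma no_socle_adj J x y : ideal J -> m y -> regular J x -> regular J y ->
  no_socle m (adj J y) -> no_socle m (adj J x).
Proof.
move=> Jid my xreg yreg ns u xu; apply: contrapT => no; apply: xu.
have mu a : m a -> adj J x (a * u).
  by move=> ma; apply: contrapT => h; apply: no; exists a.
have [v hv] := mu y my.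
have [[w hw]|] := pselect (adj J y v).
  exists w; apply: yreg; have -> : y * (u - w * x) = y * u - v * x + x * (v - w * y) by ring.
  by apply: idealD => //; apply: idealMl.
move=> /ns[a ma []]; have [c hc] := mu a ma.
exists c; apply: xreg.
have -> : x * (a * v - c * y) = y * (a * u - c * x) - a * (y * u - v * x) by ring.
by apply: idealB => //; apply: idealMl.
Qed.

Lemma depth_ge_regular k J x : ideal J -> depth_ge m J k.+1 -> m x -> regular J x ->
  depth_ge m (adj J x) k.
Proof.
elim: k J x => // k IH J x Jid [y [my yreg yk]] mx xreg.
have yid := ideal_adj Jid y; have xid := ideal_adj Jid x.
(* The given x and the y of the depth hypothesis need not be regular modulo one another, so a third
   element z mediates: y is exchanged for z, then z for x. *)
have [|z mz zreg] := regular_avoidance (N := 3)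
    (J := fun i => if i is i'.+1 then if i' is 0 then adj J x else adj J y else J) mid.
  have nsy := depth_ge_no_socle yk.
  case=> [|[|[|//]]] _; split=> //; first exact: regular_no_socle xreg.
  exact: no_socle_adj xreg yreg nsy.
have [z0 zx zy] : [/\ regular J z, regular (adj J x) z & regular (adj J y) z].
  by split; [apply: (zreg 0%N) | apply: (zreg 1%N) | apply: (zreg 2%N)].
exists z; split=> //; rewrite adjC //; apply: (IH) => //; first exact: ideal_adj.
  exists y; split=> //; first exact: regular_swap.
  by rewrite adjC //; apply: IH.
exact: regular_swap.
Qed.

End Depth.

Lemma no_socleP (m J : A -> Prop) : ideal m -> ideal J -> no_socle m J \/
  exists2 u, ~ J u & forall a, m a -> J (a * u).
Proof.
move=> mid Jid; have [|no] := pselect (no_socle m J); [by left | right].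
apply: contrapT => h; apply: no => u Ju; apply: contrapT => h'; apply: h; exists u => // a ma.
by apply: contrapT => au; apply: h'; exists a.
Qed.

(* depth(A/J) is at most dim(A/p) for every associated prime p of A/J. *)
Lemma depth_prime_chain (m J : A -> Prop) k u (H : A -> Prop) : prime_pred m ->
  ideal J -> depth_ge m J k -> ideal H -> subideal H m -> ~ J u ->
  (forall s, ~ m s -> exists t, t * s = 1) ->
  (forall h, H h -> J (h * u)) ->
  exists p : nat -> A -> Prop,
    [/\ forall i, (i <= k)%N -> prime_pred (p i), subideal H (p 0%N) &
        forall i, (i < k)%N -> subideal (p i) (p i.+1) /\ exists2 x, p i.+1 x & ~ p i x].
Proof.
move=> mP + + + + + mU; elim: k J u H => [|k IH] J u H Jid.
  move=> _ Hid Hm Ju Hu; have [v vmax uv] := max_annihilator_ex Jid Ju.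
  exists (fun=> colon J v); split=> // [_ _|h /Hu/uv //].
  exact: max_annihilator_prime vmax.
have [mid _ _] := mP.
move=> [x [mx xreg xk]] Hid Hm Ju Hu; have [v vmax uv] := max_annihilator_ex Jid Ju.
pose P := colon J v; have Pid : ideal P := ideal_colon Jid v.
pose N w := forall a, P a -> J (a * w).
have Nid : ideal N.
  split=> [a _|b w w' hw hw' a Pa]; first by rewrite mulr0; apply: ideal0.
  rewrite mulrDr mulrCA; apply: idealD => //; last exact: hw'.
  by apply: idealMl => //; apply: hw.
have Pm : subideal P m.
  move=> a Pa; apply: contrapT => /mU[t ta]; case: vmax => []; case.
  by rewrite -[v]mul1r -ta -mulrA; apply: idealMl.
(* [N] is J : P. If it were contained in J + (x), regularity of x would give N = J + x N, and
   Nakayama's lemma would put v in J. *)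
have [w Nw wx] : exists2 w, N w & ~ adj J x w.
  apply: contrapT => no; case: vmax => []; case.
  have Nx w : N w -> adj J x w.
    by move=> Nw; apply: contrapT => h; apply: no; exists w.
  have [s sN] := noetherian_fg noethA Nid.
  have [|t tm ts] := nakayama (V := A^o) (L := J) Jid mP (N := size s) (w := fun i => s`_i).
    move=> a sa; exists 1; first by case: mP.
    have Na : N s`_a by apply/sN/mem_idl/mem_nth.
    have [r hr] := Nx _ Na.
    have /sN[c rE] : N r.
      move=> b Pb; apply: xreg.
      have -> : x * (b * r) = b * s`_a - b * (s`_a - r * x) by ring.
      by apply: idealB => //; [apply: Na | apply: idealMl].
    exists (fun i => if insub i is Some i' then x * c i' else 0) => [b|].
      by case: insubP => [i _ _|_]; [apply: idealM; case: mP | apply: ideal0; case: mP].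
    rewrite scale1r; congr J: hr; congr (_ - _); rewrite rE mulr_suml.
    apply: eq_bigr => i _; rewrite valK -[RHS]/(x * c i * s`_i) -[s`_i *: c i]/(s`_i * c i); ring.
  have [t' tt'] := mU t tm.
  have /sN : N v by move=> a Pa.
  apply: idl_min => // y /(nthP 0)[i si <-].
  by rewrite -[s`_i]mul1r -tt' -mulrA; apply: idealMl => //; apply: ts.
(* All of P + (x) kills [w] modulo J + (x), so the chain supplied by induction starts strictly above
   P. *)
have [||||p [pP Hp pS]] := IH (adj J x) w (adj P x) (ideal_adj Jid x) xk.
- exact: ideal_adj Pid x.
- exact: adj_min mid Pm mx.
- exact: wx.
- move=> h [r hP]; rewrite -[h](subrK (r * x)) mulrDl; apply: idealD.
  + exact: ideal_adj.
  + by apply: subideal_adj; apply: Nw.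
  + by rewrite mulrAC; apply: idealMl; [apply: ideal_adj | apply: mem_adj].
exists (fun i => if i is i'.+1 then p i' else P); split=> [[|i] ik|h /Hu/uv//|[|i] ik].
- exact: max_annihilator_prime vmax.
- exact: pP.
- split; first by move=> a Pa; apply/Hp/subideal_adj.
  exists x; first by apply/Hp/mem_adj.
  by move=> /xreg; case: vmax.
- exact: pS.
Qed.

End ZeroDivisors.

(** * The Koszul complex *)

Section Exterior.
Variables (A : comNzRingType) (n : nat).
Implicit Types (T : {set 'I_n}) (j k : 'I_n).

(* The exterior algebra on A^n: [c T] is the coefficient of the wedge of the e_i,
   i in T, and [contract x] is the Koszul differential. *)
Definition ext := {ffun {set 'I_n} -> A^o}.
HB.instance Definition _ := GRing.Lmodule.on ext.

Definition ext_sign j T : A := (-1) ^+ (\sum_(i in T) (i < j)%N).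

Lemma ext_signU j k T : k \notin T -> ext_sign j (k |: T) = (-1) ^+ (k < j)%N * ext_sign j T.
Proof. by move=> kT; rewrite /ext_sign big_setU1 //= exprD. Qed.

Lemma ext_sign_sq j T : ext_sign j T * ext_sign j T = 1.
Proof. by rewrite /ext_sign -exprD addnn -mul2n mulnC exprM sqrr_sign. Qed.

Lemma sign_ltn_swap j k : j != k -> (-1) ^+ (j < k)%N = - (-1) ^+ (k < j)%N :> A.
Proof.
by move=> jk; case: ltngtP (jk) => [||/val_inj->]; rewrite ?eqxx //= ?expr0 ?expr1 ?opprK.
Qed.

Section Contraction.
Variable x : 'I_n -> A.

Definition contract_fun (c : ext) : ext :=
  [ffun T : {set 'I_n} => \sum_(j | j \notin T) (ext_sign j T * x j) *: c (j |: T)].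

Fact contract_is_linear : linear contract_fun.
Proof.
move=> a c c'; apply/ffunP => T; rewrite !ffunE scaler_sumr -big_split.
apply: eq_bigr => j _; rewrite !ffunE scalerDr !scalerA.
by congr (_ *: _ + _); rewrite mulrC.
Qed.
HB.instance Definition _ := GRing.isLinear.Build A ext ext _ contract_fun contract_is_linear.
Definition contract : {linear ext -> ext} := contract_fun.

Definition wedge_fun (c : ext) : ext :=
  [ffun T : {set 'I_n} => \sum_(j in T) (ext_sign j T * x j) *: c (T :\ j)].

Fact wedge_is_linear : linear wedge_fun.
Proof.
move=> a c c'; apply/ffunP => T; rewrite !ffunE scaler_sumr -big_split.
apply: eq_bigr => j _; rewrite !ffunE scalerDr !scalerA.
by congr (_ *: _ + _); rewrite mulrC.
Qed.
HB.instance Definition _ := GRing.isLinear.Build A ext ext _ wedge_fun wedge_is_linear.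
Definition wedge : {linear ext -> ext} := wedge_fun.

End Contraction.

(** The pairs are split by order and the two halves cancel; a division by 2 would exclude some
    rings. *)
Lemma sum_antisym (P : pred 'I_n) (f : 'I_n -> 'I_n -> A) :
  (forall j k, j != k -> f j k = - f k j) ->
  \sum_(j | P j) \sum_(k | P k && (k != j)) f j k = 0.
Proof.
move=> fN.
have split_lt j : \sum_(k | P k && (k != j)) f j k =
    \sum_(k | P k && (k < j)%N) f j k - \sum_(k | P k && (j < k)%N) f k j.
  rewrite (bigID (fun k : 'I_n => (k < j)%N)) /=; congr (_ + _).
    by apply: eq_bigl => k; rewrite -(inj_eq val_inj); case: ltngtP; rewrite ?andbT ?andbF.
  rewrite -sumrN; apply: eq_big => [k|k].
    by rewrite -(inj_eq val_inj); case: ltngtP; rewrite ?andbT ?andbF.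
  by move=> /andP[/andP[_ kj] _]; apply: fN; rewrite eq_sym.
rewrite (eq_bigr _ (fun j _ => split_lt j)) sumrB.
rewrite (exchange_big_dep P) /=; last by move=> j k _ /andP[].
apply/eqP; rewrite subr_eq0; apply/eqP; apply: eq_bigr => k Pk.
by apply: eq_bigl => j; rewrite Pk.
Qed.

Lemma contractK x c : contract x (contract x c) = 0.
Proof.
apply/ffunP => T; rewrite !ffunE.
pose f j k := ext_sign j T * ext_sign k T * (-1) ^+ (j < k)%N * x j * x k * c (k |: (j |: T)).
rewrite -[RHS](@sum_antisym (fun j => j \notin T) f); last first.
  move=> j k jk; rewrite /f (sign_ltn_swap jk) setUCA; ring.
apply: eq_bigr => j jT; rewrite ffunE scaler_sumr; apply: eq_big => [k|k].
  by rewrite in_setU1 negb_or andbC.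
rewrite in_setU1 negb_or => /andP[_ kT].
rewrite scalerA ext_signU // /f -[_ *: _]/(_ * _); ring.
Qed.

(** Wedging with the vector r is a null homotopy for multiplication by the sum of the r_j x_j. The
    terms with equal indices give this factor; the mixed ones cancel by sign. *)
Lemma contract_wedge x r c :
  contract x (wedge r c) + wedge r (contract x c) = (\sum_j r j * x j) *: c.
Proof.
apply/ffunP => T; rewrite !ffunE [in RHS](bigID (mem T)) /= scalerDl addrC.
pose f j k := ext_sign k T * ext_sign j (T :\ k) * x j * r k * c (j |: (T :\ k)).
have -> : \sum_(k in T) (ext_sign k T * r k) *: contract x c (T :\ k) =
    (\sum_(k in T) r k * x k) *: c T + \sum_(k in T) \sum_(j | j \notin T) f j k.
  rewrite scaler_suml -big_split; apply: eq_bigr => k kT.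
  rewrite ffunE (bigD1 k) /=; last by rewrite !inE eqxx.
  rewrite setD1K // scalerDr scalerA; congr (_ + _).
    have -> : ext_sign k (T :\ k) = ext_sign k T.
      by rewrite -{2}(setD1K kT) ext_signU ?ltnn ?mul1r // !inE eqxx.
    by rewrite mulrACA ext_sign_sq mul1r.
  rewrite scaler_sumr; apply: eq_big => [j|j _].
    rewrite !inE; case: eqVneq => [->|] /=; [by rewrite kT | by rewrite andbT].
  by rewrite scalerA /f -[_ *: _]/(_ * _); ring.
have -> : \sum_(j | j \notin T) (ext_sign j T * x j) *: wedge r c (j |: T) =
    (\sum_(j | j \notin T) r j * x j) *: c T - \sum_(j | j \notin T) \sum_(k in T) f j k.
  rewrite scaler_suml -sumrB; apply: eq_bigr => j jT.
  rewrite ffunE big_setU1 //= setU1K // scalerDr scalerA; congr (_ + _).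
    by rewrite ext_signU // ltnn mul1r mulrACA ext_sign_sq mul1r mulrC.
  rewrite scaler_sumr -sumrN; apply: eq_bigr => k kT.
  have jk : j != k by apply: contraNneq jT => ->.
  have -> : (j |: T) :\ k = j |: (T :\ k).
    apply/setP => i; rewrite !inE; case: (eqVneq i j) => [->|]; rewrite ?jk ?orbF //=.
  rewrite scalerA ext_signU // -{1}(setD1K kT) ext_signU; last by rewrite !inE eqxx.
  rewrite (sign_ltn_swap jk) /f -[_ *: _]/(_ * _).
  have := sqrr_sign A (k < j)%N; rewrite expr2; set s := _ ^+ (k < j)%N => sq.
  by rewrite -[RHS]mul1r -{1}sq; ring.
by rewrite addrACA [X in _ + (_ - X)]exchange_big /= subrr addr0.
Qed.

Definition in_ext (J : A -> Prop) (c : ext) : Prop := forall T, J (c T).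
Definition homog p (c : ext) : Prop := forall T, #|T| != p -> c T = 0.

Lemma submod_in_ext J : ideal J -> submod (in_ext J).
Proof.
move=> Jid; split=> [T|a u v uJ vJ T]; rewrite ffunE; first exact: ideal0.
by rewrite ffunE; apply: Jid.2.
Qed.

Lemma submod_homog p : submod (homog p).
Proof.
split=> [T _|a u v hu hv T Tp]; rewrite !ffunE // hu // hv //.
by rewrite scaler0 addr0.
Qed.

Lemma in_ext_contract J x c : ideal J -> in_ext J c -> in_ext J (contract x c).
Proof.
move=> Jid cJ T; rewrite ffunE; apply: (@submod_sum _ A^o J) => // j _.
exact: idealMl.
Qed.

Lemma in_ext_wedge J r c : ideal J -> in_ext J c -> in_ext J (wedge r c).
Proof.
move=> Jid cJ T; rewrite ffunE; apply: (@submod_sum _ A^o J) => // j _.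
exact: idealMl.
Qed.

Lemma homog_contract p x c : homog p.+1 c -> homog p (contract x c).
Proof.
move=> hc T Tp; rewrite ffunE big1 // => j jT.
by rewrite hc ?scaler0 // cardsU1 jT add1n eqSS.
Qed.

Lemma homog_wedge p r c : homog p c -> homog p.+1 (wedge r c).
Proof.
move=> hc T Tp; rewrite ffunE big1 // => j jT; rewrite hc ?scaler0 //.
by move: Tp; rewrite (cardsD1 j) jT add1n eqSS.
Qed.

Lemma in_ext_adj p J y c : ideal J -> homog p c -> in_ext (adj J y) c ->
  exists2 v, homog p v & in_ext J (c - y *: v).
Proof.
move=> Jid hc cJ.
pose v : ext := [ffun T : {set 'I_n} => if #|T| == p then sval (cid (cJ T)) else 0].
exists v => [T /negPf Tp|T]; first by rewrite ffunE Tp.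
rewrite !ffunE; case: ifPn => [_|Tp]; last first.
  by rewrite hc // scaler0 subr0; apply: ideal0.
by case: cid => r /=; rewrite mulrC.
Qed.

Section Lifting.
Variable x : 'I_n -> A.

(* Every p-cycle of the Koszul complex over A/(J + (z)) is, up to a boundary,
   the reduction of a p-cycle over A/J. *)
Definition liftable (J : A -> Prop) z p : Prop :=
  forall b, homog p b -> in_ext (adj J z) (contract x b) ->
  exists b' b'', [/\ homog p b', homog p.+1 b'', in_ext J (contract x b') &
    in_ext (adj J z) (b - b' - contract x b'')].

(** In top degree a chain is a single coefficient and there are no boundaries, so lifting cycles is
    exactly the colon identity. *)
Lemma liftable_top J z : ideal J ->
  (forall a, (forall j, adj J z (a * x j)) ->
     exists2 b, forall j, J (b * x j) & adj J z (a - b)) ->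
  liftable J z n.
Proof.
move=> Jid colonJ b hb bJ.
have [|a aJ ba] := colonJ (b setT).
  (* At the complement of j the differential has the single term x_j [b setT], up to sign. *)
  move=> j; have := bJ (~: [set j]); rewrite ffunE (big_pred1 j); last first.
    by move=> k; rewrite !inE negbK.
  have -> : j |: ~: [set j] = setT by rewrite setUCr.
  move/(idealMl (ideal_adj Jid z) (ext_sign j (~: [set j]))).
  by rewrite -[_ *: _]/(_ * _) !mulrA ext_sign_sq mul1r mulrC.
pose b' : ext := [ffun T : {set 'I_n} => if T == setT then a else 0].
have card_top T : (#|T| != n) = (T != setT).
  have := max_card (mem T); rewrite card_ord => Tn.
  by rewrite eqEcard subsetT cardsT card_ord -ltnNge ltn_neqAle Tn andbT.
exists b', 0; split=> [T|T _|T|T].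
- by rewrite card_top ffunE => /negPf->.
- by rewrite ffunE.
- rewrite ffunE; apply: (@submod_sum _ A^o J) => // j _; rewrite ffunE.
  case: ifP => _; last by rewrite scaler0; apply: ideal0.
  by rewrite -[_ *: _]/(_ * _) -mulrA; apply: idealMl => //; rewrite mulrC.
- rewrite linear0 subr0 !ffunE; case: eqVneq => [->//|TT].
  by rewrite hb ?card_top // subr0; apply: ideal0 (ideal_adj Jid z).
Qed.

(** Since y kills Koszul homology, H_p over A/J is the image of the connecting map from H_(p+1) over
    A/(J + (y)), and wedging with r gives explicit preimages. Lifting there and applying the
    connecting map gives a lift here. *)
Lemma liftable_step J z p y r : ideal J -> y = \sum_j r j * x j ->
  regular J y -> regular (adj J z) y -> liftable (adj J y) z p.+1 -> liftable J z p.
Proof.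
move=> Jid yE yJ yJz lift b hb bJz.
have Jz := ideal_adj Jid z; have Jy := ideal_adj Jid y; have Jyz := ideal_adj Jy z.
have wE : contract x (wedge r b) = y *: b - wedge r (contract x b).
  by rewrite yE -contract_wedge addrK.
have yB c : in_ext (adj (adj J y) z) (y *: c).
  move=> T; rewrite ffunE; apply/subideal_adj => //; apply: (idealM Jy).
  exact: mem_adj.
have sub c : in_ext (adj J z) c -> in_ext (adj (adj J y) z) c.
  by move=> cJ T; rewrite adjC //; apply: subideal_adj.
have [||b' [b'' [hb' hb'' b'J wJ]]] := lift (wedge r b); first exact: homog_wedge.
  rewrite wE; apply: (submodB (submod_in_ext Jyz) (yB _)).
  by apply: sub; apply: in_ext_wedge.
(* The connecting map: the differential of [b'] is [y] times [beta] modulo J. *)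
have [beta hbeta betaJ] := in_ext_adj Jid (homog_contract x hb') b'J.
rewrite adjC // in wJ.
have [|v hv vJ] := in_ext_adj (p := p.+1) Jz _ wJ.
  apply: (submodB (@submod_homog _)); last exact: homog_contract.
  by apply: (submodB (@submod_homog _)) => //; apply: homog_wedge.
exists beta, v; split=> // T.
  apply: yJ; have := in_ext_contract x Jid betaJ T.
  rewrite linearB /= contractK sub0r linearZ 2!ffunE => h.
  by have := idealN Jid h; rewrite opprK.
(* Differentiating the relation r /\ b = b' + d b'' + y v modulo J + (z) gives y (b - beta - d v) =
   0 there, and y cancels. *)
apply: yJz.
have h1 := submodD (submod_in_ext Jz) (in_ext_contract x Jz vJ) (in_ext_wedge r Jz bJz).
have h2 : in_ext (adj J z) (contract x b' - y *: beta).
  by move=> S; apply/subideal_adj/betaJ.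
have := submodD (submod_in_ext Jz) h1 h2 T; congr adj.
rewrite !linearB /= contractK subr0 wE linearZ /=.
by rewrite !ffunE; do ![rewrite -[_ *: _]/(_ * _)]; ring.
Qed.

Lemma liftable_seq (J : A -> Prop) z p ys : ideal J ->
  (forall s y t, ys = s ++ y :: t ->
     [/\ regular (foldl (@adj A) J s) y, regular (adj (foldl (@adj A) J s) z) y &
        exists r, y = \sum_j r j * x j]) ->
  liftable (foldl (@adj A) J ys) z (p + size ys)%N -> liftable J z p.
Proof.
elim: ys J p => [|y ys IH] J p Jid h; first by rewrite /= addn0.
move=> lift; have [yJ yJz [r yE]] := h [::] y ys erefl.
apply: (liftable_step Jid yE yJ yJz); apply: IH.
- exact: ideal_adj.
- by move=> s y' t e; apply: (h (y :: s) y' t); rewrite e.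
- by rewrite addSnnS.
Qed.

End Lifting.

End Exterior.

(** * Regular sequences and the ideals they generate *)

Section RegularSequences.
Variable A : comNzRingType.
Implicit Types (J : A -> Prop) (s : seq A).

Definition adjs J s : A -> Prop := foldl (@adj A) J s.

Fixpoint regulars J s : Prop :=
  if s is x :: s' then regular J x /\ regulars (adj J x) s' else True.

Lemma adjs_rcons J s x : adjs J (rcons s x) = adj (adjs J s) x.
Proof. by rewrite /adjs foldl_rcons. Qed.

Lemma regulars_rcons J s x :
  regulars J (rcons s x) <-> regulars J s /\ regular (adjs J s) x.
Proof.
elim: s J => [|y s IH] J /=; first by split=> [[]|[]].
by rewrite IH; split=> [[? []]|[[]]].
Qed.

Lemma ideal_adjs J s : ideal J -> ideal (adjs J s).
Proof. by elim: s J => //= x s IH J Jid; apply/IH/ideal_adj. Qed.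

Lemma idl_nil : idl [::] = (fun a : A => a = 0).
Proof.
apply: pred_ext => a; split=> [/in_span_nil//|->]; exact: ideal0 (ideal_span _).
Qed.

Lemma idl_adjs s : idl s = adjs (fun a => a = 0) s.
Proof.
elim/last_ind: s => [|s x IH]; first exact: idl_nil.
by rewrite idl_rcons adjs_rcons IH.
Qed.

Lemma adjsP J s a : ideal J -> adjs J s a <-> exists2 b, J b & idl s (a - b).
Proof.
move=> Jid; elim/last_ind: s a => [|s x IH] a.
  rewrite /= idl_nil; split=> [Ja|[b Jb /eqP]]; first by exists a; rewrite ?subrr.
  by rewrite subr_eq0 => /eqP->.
rewrite adjs_rcons idl_rcons; split=> [[r /IH[b Jb h]]|[b Jb [r h]]].
  by exists b => //; exists r; rewrite addrAC.
by exists r; apply/IH; exists b => //; rewrite addrAC.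
Qed.

End RegularSequences.

(** * The graded Koszul complex inside the exterior algebra, and H_1 *)

Section KoszulExt.
Variables (A : comNzRingType) (x : seq A).
Local Notation n := (size x).
Local Notation xi := (fun i : 'I_n => x`_i).

Definition to_ext p (c : koszul x p) : ext A n :=
  [ffun T : {set 'I_n} => if insub T is Some U then (c U : A^o) else (0 : A^o)].
Definition of_ext p (c : ext A n) : koszul x p := [ffun S => c (val S)].

Lemma to_extE p (c : koszul x p) S : to_ext c (val S) = c S.
Proof. by rewrite ffunE valK. Qed.

Lemma homog_to_ext p (c : koszul x p) : homog p (to_ext c).
Proof. by move=> T Tp; rewrite ffunE insubN. Qed.

Lemma of_extK p (c : ext A n) : homog p c -> to_ext (of_ext p c) = c.
Proof.
move=> hc; apply/ffunP => T; rewrite ffunE; case: insubP => [S _ <-|/hc->//].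
by rewrite ffunE.
Qed.

Lemma to_ext_is_linear p : linear (@to_ext p).
Proof.
move=> a c c'; apply/ffunP => T; rewrite !ffunE.
by case: insubP => [S _ _|_]; rewrite ?ffunE // scaler0 addr0.
Qed.
HB.instance Definition _ p := GRing.isLinear.Build A (koszul x p) (ext A n) _
  (@to_ext p) (@to_ext_is_linear p).

Lemma to_ext_diff p (c : koszul x p.+1) :
  to_ext (koszul_diff x p c) = contract xi (to_ext c).
Proof.
apply/ffunP => T; have [Tp|Tp] := eqVneq #|T| p; last first.
  by rewrite homog_to_ext // (homog_contract _ (homog_to_ext c)).
have TP : #|T| == p by apply/eqP.
rewrite -[T]/(val (exist _ T TP : koszul_index x p)) to_extE !ffunE /=.
rewrite (exchange_big_dep xpredT) //= [RHS]big_mkcond; apply: eq_bigr => j _.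
case: ifPn => [jT|jT]; last first.
  rewrite big1 // => S /andP[jS /eqP e]; case/negP: jT.
  by rewrite -e !inE eqxx.
have jTp : #|j |: T| == p.+1 by rewrite cardsU1 jT Tp add1n.
rewrite (big_pred1 (exist _ (j |: T) jTp)) => [|S] /=; last first.
  apply/andP/eqP => [[jS /eqP e]|->]; last by rewrite setU11 setU1K.
  by apply: val_inj; rewrite /= -e setD1K.
rewrite -[c _]to_extE /=; congr ((_ * _) *: _); rewrite /ext_sign; congr (_ ^+ _).
by rewrite -sum1dep_card big_mkcondr big_setU1 //= ltnn add0n.
Qed.

(** The first Koszul differential with values in A, as K_0 has the single basis vector of the empty
    set. *)
Definition ev (c : koszul x 1) : A := to_ext (koszul_diff x 0 c) set0.
(** Since S is a singleton, the sum just picks the entry of r at its element. *)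
Definition vec (r : 'I_n -> A) : koszul x 1 :=
  [ffun S : koszul_index x 1 => \sum_(j in val S) r j : A^o].

Lemma ev_is_linear a c c' : ev (a *: c + c') = a * ev c + ev c'.
Proof. by rewrite /ev !linearP !ffunE. Qed.

Lemma ev_eq0 c : ev c = 0 -> koszul_diff x 0 c = 0.
Proof.
move=> c0; apply/ffunP => S; rewrite -to_extE [RHS]ffunE -[RHS]c0.
by congr (to_ext _ _); apply/cards0_eq/eqP; case: S.
Qed.

Lemma evE c : ev c = \sum_(j < n) x`_j * to_ext c [set j].
Proof.
rewrite /ev to_ext_diff ffunE; apply: eq_big => [j|j _]; first by rewrite inE.
by rewrite /ext_sign big_set0 mul1r setU0.
Qed.

Lemma to_ext_vec r j : to_ext (vec r) [set j] = r j.
Proof.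
have j1 : #|[set j]| == 1%N by rewrite cards1.
by rewrite -[[set j]]/(val (exist _ [set j] j1 : koszul_index x 1)) to_extE ffunE big_set1.
Qed.

Lemma vecK c : vec (fun j => to_ext c [set j]) = c.
Proof.
apply/ffunP => -[S Sp]; rewrite ffunE /=; have /cards1P[j e] := Sp.
by rewrite (big_pred1 j) => [|i]; rewrite ?e ?inE // -to_extE /= e.
Qed.

Lemma ev_vec r : ev (vec r) = \sum_(j < n) x`_j * r j.
Proof. by rewrite evE; apply: eq_bigr => j _; rewrite to_ext_vec. Qed.

Lemma idl_ev a : idl x a <-> exists c, ev c = a.
Proof.
split=> [[r ->]|[c <-]]; first by exists (vec r); rewrite ev_vec.
by exists (fun j => to_ext c [set j]); rewrite evE.
Qed.

(* Tor_1(A/I, A/(s)) = 0 : since s is regular on A/I, (s) meets I in (s)I. *)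
Lemma ev_cap s a : regulars (idl x) s -> idl x a -> idl s a ->
  exists2 c : koszul x 1, forall S, idl s (c S) & ev c = a.
Proof.
elim/last_ind: s a => [|s z IH] a.
  move=> _ _; rewrite idl_nil => ->; exists 0 => [S|]; first by rewrite ffunE.
  by rewrite /ev !linear0 ffunE.
have xid := ideal_span x; have sid := ideal_span s.
rewrite regulars_rcons idl_rcons => -[sreg zreg] xa [r sa].
(* As a = r z modulo (s) and a lies in I, regularity of z puts r in I + (s); the part of r in I
   accounts for the multiple of z. *)
have [|i xi /(idealMl sid z) si] := (adjsP s r xid).1 (zreg r _).
  apply/(adjsP _ _ xid); exists a => //; rewrite -opprB mulrC; exact: idealN.
have [ci ciE] := (idl_ev i).1 xi.
have [||c cs cE] := IH (a - z * i) sreg.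
- by apply: idealB => //; apply: idealMl.
- have -> : a - z * i = a - r * z + z * (r - i) by ring.
  exact: idealD.
exists (z *: ci + c) => [S|]; last by rewrite ev_is_linear ciE cE addrC subrK.
exists (ci S); rewrite !ffunE -[z *: _]/(z * _) mulrC addrAC subrr add0r; exact: cs.
Qed.

Local Notation H1 := (koszul_H1 x).
Local Notation d1 := (koszul_diff x 1).
Local Notation d0 := (koszul_diff x 0).
Local Notation pi1 := (\pi_(homology d1 d0)).

Lemma ker_ev c : c \in in_ker d0 <-> ev c = 0.
Proof.
split=> [/eqP c0|/ev_eq0 c0]; last exact/eqP.
by rewrite /ev c0 linear0 ffunE.
Qed.

Lemma cycle_valZ a (z : Defs.cycle d0) : val (a *: z) = a *: val z.
Proof. by rewrite linearZ. Qed.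

Lemma cycle_val0 : val (0 : Defs.cycle d0) = 0.
Proof. by rewrite raddf0. Qed.

Lemma cycle_valB (y z : Defs.cycle d0) : val (y - z) = val y - val z.
Proof. by rewrite raddfB. Qed.

Lemma pi_eq (y z : Defs.cycle d0) : pi1 y = pi1 z <-> exists u, val y - val z = d1 u.
Proof.
have -> : (exists u, val y - val z = d1 u) <-> y - z \in boundaries d1 d0.
  by split=> [h|/asboolP//]; apply/asboolP.
by rewrite Quotient.idealrBE; split=> /eqP.
Qed.

Lemma pi_scale a (z : Defs.cycle d0) : a *: (pi1 z : H1) = pi1 (a *: z).
Proof. exact: pi_homology_scale. Qed.

(* For a cycle c and s regular on A and A/(x), this says that the class of c lies
   in (s) H1. *)
Definition boundary_mod s (c : koszul x 1) : Prop :=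
  exists b, forall S, idl s ((c - d1 b) S).

Lemma H1_span_boundary s (z : Defs.cycle d0) :
  in_span s (pi1 z : H1) -> boundary_mod s (val z).
Proof.
move=> [h hE].
have /pi_eq[b bE] : pi1 z = pi1 (\sum_(i < size s) s`_i *: repr (h i)).
  rewrite [LHS]hE raddf_sum; apply: eq_bigr => i _.
  by rewrite -[h i in LHS]reprK; apply: pi_scale.
exists b => S; rewrite -bE subKr raddf_sum sum_ffunE.
exists (fun i => val (repr (h i)) S); apply: eq_bigr => i _.
transitivity ((s`_i *: val (repr (h i))) S); last by rewrite ffunE.
by congr (fun_of_fin _ S); apply: cycle_valZ.
Qed.

(** This is the embedding of H_1/(s)H_1 into H_1 (x; A/(s)). Writing a boundary modulo (s, a) as d b
    + a c modulo (s), the chain c is a cycle only modulo (s); [ev_cap] replaces it by a true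
    cycle. *)
Lemma boundary_H1_span s (z : Defs.cycle d0) :
  regulars (fun a => a = 0) s -> regulars (idl x) s ->
  boundary_mod s (val z) -> in_span s (pi1 z : H1).
Proof.
elim/last_ind: s z => [|s a IH] z.
  move=> _ _ [b bE]; have -> : pi1 z = pi1 0.
    apply/pi_eq; exists b; rewrite cycle_val0 subr0.
    apply/eqP; rewrite -subr_eq0; apply/eqP/ffunP => S.
    by have := bE S; rewrite idl_nil => ->; rewrite ffunE.
  rewrite raddf0; exact: submod0 (submod_span _ _).
rewrite !regulars_rcons -idl_adjs => -[s0 a0] [sx ax] [b bE].
have sid := ideal_span s.
have rP S : exists r, idl s ((val z - d1 b) S - r * a) by have := bE S; rewrite idl_rcons.
pose c : koszul x 1 := [ffun S => sval (cid (rP S))].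
have cE S : idl s ((val z - d1 b - a *: c) S).
  have -> : (val z - d1 b - a *: c) S = (val z - d1 b) S - sval (cid (rP S)) * a.
    rewrite [LHS]ffunE; congr (_ + _); rewrite ffunE; congr (- _).
    by rewrite ffunE [c S]ffunE; apply: mulrC.
  by case: cid.
have evs (c' : koszul x 1) : (forall S, idl s (c' S)) -> idl s (ev c').
  move=> c's; rewrite evE; apply: (@submod_sum _ A^o) => // j _; apply: idealMl => //.
  by rewrite ffunE; case: insub => [U|]; [apply: c's | apply: ideal0].
have evd u : ev (d1 u) = 0.
  by rewrite /ev !to_ext_diff contractK ffunE.
have evz (y : Defs.cycle d0) : ev (val y) = 0 by apply/ker_ev; case: y.
have evB u v : ev (u - v) = ev u - ev v.
  by rewrite addrC -scaleN1r ev_is_linear mulN1r addrC.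
have evZ r u : ev (r *: u) = r * ev u.
  by rewrite -[r *: u]addr0 ev_is_linear {2}/ev !linear0 ffunE addr0.
(* Applying [ev] leaves a times [ev c] in (s), and a is regular modulo (s). *)
have cs : idl s (ev c).
  apply: a0; have := evs _ cE; rewrite !evB evz evd evZ subrr sub0r => /(idealN sid).
  by rewrite opprK.
have [|c' c's c'E] := ev_cap sx _ cs; first by apply/idl_ev; exists c.
have yP : c - c' \in in_ker d0 by apply/ker_ev; rewrite evB c'E subrr.
pose y : Defs.cycle d0 := Cycle yP.
apply/in_span_rcons; exists (pi1 y); rewrite pi_scale -raddfB.
apply: IH => //; exists b => S.
have -> : val (z - a *: y) - d1 b = (val z - d1 b - a *: c) + a *: c'.
  by rewrite cycle_valB cycle_valZ /= scalerBr opprB addrAC addrA addrAC.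
by rewrite ffunE [(a *: c') S]ffunE; exact: (idealD sid (cE S) (idealMl sid a (c's S))).
Qed.

(** If z c = d b modulo (s), then b is a 2-cycle modulo (s, z). Lifting it leaves b = b' + d b'' + z
    v with b' a cycle modulo (s), so z c = z d v and z cancels. *)
Lemma boundary_mod_regular s z c : regular (idl s) z -> liftable xi (idl s) z 2%N ->
  boundary_mod s (z *: c) -> boundary_mod s c.
Proof.
move=> zreg lift [b bE]; have sid := ideal_span s.
have zid := ideal_adj sid z.
have bE' : in_ext (idl s) (z *: to_ext c - contract xi (to_ext b)).
  rewrite -to_ext_diff -linearZ -linearB => T; rewrite ffunE.
  by case: insub => [S|]; [apply: bE | apply: ideal0].
have [|b' [b'' [hb' hb'' b's w]]] := lift _ (homog_to_ext b).
  move=> T; exists (to_ext c T); have := idealN sid (bE' T).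
  by rewrite !ffunE opprB /= mulrC.
have [|v hv vs] := in_ext_adj (p := 2%N) sid _ w.
  apply: (submodB (@submod_homog _ _ _)); last exact: homog_contract.
  by apply: (submodB (@submod_homog _ _ _)) => //; apply: homog_to_ext.
exists (of_ext 2%N v) => S; rewrite -to_extE linearB /= to_ext_diff of_extK //.
apply: zreg.
have h1 := submodD (submod_in_ext n sid) (in_ext_contract xi sid vs) bE'.
have := submodD (submod_in_ext n sid) h1 b's (val S); congr idl.
rewrite !linearB /= contractK subr0 linearZ /=.
move: (contract xi (to_ext b)) (contract xi b') (contract xi v) (to_ext c) => e1 e2 e3 e4.
by rewrite !ffunE -![z *: _]/(z * _); ring.
Qed.

(** Cycles of degree one are the syzygies of x, a submodule of a free module of finite rank. *)
Lemma H1_fg : noetherian A -> exists N (h : 'I_N -> H1),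
  forall u, exists c : 'I_N -> A, u = \sum_b c b *: h b.
Proof.
move=> noethA; pose L (v : 'rV[A]_n) := ev (vec (v 0)) = 0.
have vec_lin a (u v : 'rV_n) : vec ((a *: u + v) 0) = a *: vec (u 0) + vec (v 0).
  apply/ffunP => S; rewrite !ffunE scaler_sumr -big_split.
  by apply: eq_bigr => j _; rewrite !mxE.
have Lsub : submod L.
  split=> [|a u v]; rewrite /L.
    by rewrite ev_vec big1 // => j _; rewrite mxE mulr0.
  by rewrite vec_lin ev_is_linear => -> ->; rewrite mulr0 addr0.
have [N [Q [QL Qgen]]] := fg_row_submod noethA Lsub.
pose y b : Defs.cycle d0 := Cycle ((ker_ev _).2 (QL b)).
exists N, (fun b => pi1 (y b)) => u.
have [|r rE] := Qgen (\row_j to_ext (val (repr u)) [set j]).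
  rewrite /L (_ : vec _ = val (repr u)); first by apply/ker_ev; case: (repr u).
  rewrite -[RHS]vecK; apply/ffunP => S; rewrite !ffunE.
  by apply: eq_bigr => j _; rewrite mxE.
exists (r 0); rewrite -[LHS]reprK.
have -> : repr u = \sum_b r 0 b *: y b.
  apply: val_inj; rewrite raddf_sum -[LHS]vecK.
  have -> : vec (fun j => to_ext (val (repr u)) [set j]) = vec ((r *m Q) 0).
    by rewrite -rE; apply/ffunP => S; rewrite !ffunE; apply: eq_bigr => j _; rewrite mxE.
  apply/ffunP => S; rewrite sum_ffunE ffunE.
  under eq_bigr do rewrite mxE.
  rewrite exchange_big; apply: eq_bigr => b _.
  transitivity ((r 0 b *: val (y b)) S); last by congr (fun_of_fin _ S); rewrite cycle_valZ.
  rewrite !ffunE scaler_sumr; apply: eq_bigr => j _; by rewrite mxE.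
by rewrite raddf_sum; apply: eq_bigr => b _; rewrite pi_scale.
Qed.

Lemma H1_spanned_eq0 (m : A -> Prop) s : noetherian A -> prime_pred m ->
  (forall a, ~ m a -> exists t, t * a = 1) -> (forall z, z \in s -> m z) ->
  (forall u : H1, in_span s u) -> forall u : H1, u = 0.
Proof.
move=> noethA mP mU sm spanned; have [mid m1 _] := mP.
have [N [h hgen]] := H1_fg noethA.
pose w b : H1 := if insub b is Some b' then h b' else 0.
have wE (b : 'I_N) : w b = h b by rewrite /w valK.
have zero_sub : submod (fun u : H1 => u = 0).
  by split=> // a u v -> ->; rewrite scaler0 addr0.
have [a aN|t /mU[t' tt'] tw] := nakayama zero_sub mP (N := N) (w := w).
  exists 1; rewrite // scale1r.
  have [v vE] := spanned (w a).
  have cP i : exists c : 'I_N -> A, v i = \sum_b c b *: h b by apply: hgen.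
  pose c i := sval (cid (cP i)).
  pose e b := \sum_(i < size s) s`_i * c i b.
  exists (fun b => if insub b is Some b' then e b' else 0) => [b|].
    case: insub => [b'|]; last exact: ideal0.
    apply: (@submod_sum _ A^o m mid) => // i _.
    by apply: (idealM mid); apply/sm/mem_nth.
  rewrite vE; apply/eqP; rewrite subr_eq0; apply/eqP.
  transitivity (\sum_(i < size s) \sum_b (s`_i * c i b) *: h b).
    apply: eq_bigr => i _; rewrite {1}(_ : v i = \sum_b c i b *: h b).
      by rewrite scaler_sumr; apply: eq_bigr => b _; rewrite scalerA.
    by rewrite /c; case: cid.
  rewrite exchange_big; apply: eq_bigr => b _.
  by rewrite valK wE scaler_suml.
move=> u; have [c ->] := hgen u; rewrite big1 // => b _.
by rewrite -wE -[w b]scale1r -tt' -[(t' * t) *: _]scalerA tw ?scaler0 // ltn_ord.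
Qed.

End KoszulExt.

(** * Extension of regular sequences, and depth along them *)

Section RegularSequenceFacts.
Variable A : comNzRingType.
Implicit Types (J : A -> Prop) (s : seq A).

Lemma regulars_nth J s :
  (forall i, (i < size s)%N -> regular (adjs J (take i s)) s`_i) -> regulars J s.
Proof.
elim/last_ind: s => // s x IH h; apply/regulars_rcons; split.
  apply: IH => i si; have := h i; rewrite size_rcons ltnS (ltnW si) nth_rcons si.
  by rewrite -cats1 takel_cat ?(ltnW si) //; apply.
have := h (size s); rewrite size_rcons ltnS leqnn nth_rcons ltnn eqxx.
by rewrite -cats1 take_size_cat //; apply.
Qed.

Lemma regulars_cat J s t : regulars J (s ++ t) <-> regulars J s /\ regulars (adjs J s) t.
Proof.
elim: s J => [|x s IH] J /=; first by split=> [|[]].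
by rewrite IH; split=> [[? []]|[[]]].
Qed.

Lemma adjs_adj J s z : ideal J -> adjs (adj J z) s = adj (adjs J s) z.
Proof.
elim: s J => // x s IH J Jid /=; rewrite (adjC z x Jid); exact/IH/ideal_adj.
Qed.

Lemma subideal_adjs J s : ideal J -> subideal J (adjs J s).
Proof.
elim: s J => [|x s IH] J Jid a // Ja /=.
by apply: IH; [apply: ideal_adj | apply: subideal_adj].
Qed.

Lemma mem_adjs J s x : ideal J -> x \in s -> adjs J s x.
Proof.
elim: s J => // y s IH J Jid; rewrite inE => /predU1P[->|xs] /=.
  by apply: subideal_adjs; [apply: ideal_adj | apply: mem_adj].
by apply: IH => //; apply: ideal_adj.
Qed.

Lemma adjs_min J s (K : A -> Prop) : ideal K -> subideal J K ->
  (forall x, x \in s -> K x) -> subideal (adjs J s) K.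
Proof.
move=> Kid; elim: s J => [|x s IH] J JK sK //=; apply: IH => [|y ys].
  by apply: adj_min => //; apply: sK; apply: mem_head.
by apply: sK; rewrite inE ys orbT.
Qed.

Lemma regulars_depth_ge (m J : A -> Prop) s :
  (forall x, x \in s -> m x) -> regulars J s -> depth_ge m J (size s).
Proof.
elim: s J => //= x s IH J sm [xJ sJ]; exists x; split=> //; first by apply/sm/mem_head.
by apply: IH => // y ys; apply: sm; rewrite inE ys orbT.
Qed.

Lemma depth_geW (m J : A -> Prop) k l : (l <= k)%N -> depth_ge m J k -> depth_ge m J l.
Proof.
elim: l k J => // l IH [//|k] J lk [x [mx xJ xk]].
by exists x; split=> //; apply: IH xk.
Qed.

Hypothesis noethA : noetherian A.

Lemma depth_ge_adjs (m J : A -> Prop) s k : ideal m -> ideal J ->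
  (forall x, x \in s -> m x) -> regulars J s -> depth_ge m J k ->
  depth_ge m (adjs J s) (k - size s)%N.
Proof.
move=> mid; elim: s J k => [|x s IH] J k Jid sm /=; first by rewrite subn0.
case: k => [|k] [xJ sJ] Jk; first by rewrite sub0n.
rewrite subSS; apply: IH => //; first exact: ideal_adj.
  by move=> y ys; apply: sm; rewrite inE ys orbT.
by apply: depth_ge_regular => //; apply/sm/mem_head.
Qed.

Lemma regular_sequence_extend (M : lmodType A) (J : {pred A}) s :
  {subset s <= J} -> regular_sequence M s ->
  exists2 s', maximal_regular_sequence J M s' & (size s <= size s')%N.
Proof.
suff main K : ideal K -> forall s, idl s = K -> {subset s <= J} -> regular_sequence M s ->
    exists2 s', maximal_regular_sequence J M s' & (size s <= size s')%N.
  exact: main (ideal_span s) s erefl.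
move: K; apply: (noetherian_ind noethA) => K Kid IH {}s sK sJ sreg.
have [[x xJ xreg]|no] := pselect (exists2 x, x \in J & regular_sequence M (rcons s x)); last first.
  by exists s => //; split=> // x xJ xreg; apply: no; exists x.
(* If x were in (s), it would act as 0 on M/sM; being regular there, it would force M = sM. *)
have xs : ~ idl s x.
  move=> sx; have [hs [u nu]] := xreg; case: nu.
  have sM := submod_span M s.
  have sxv (v : M) : in_span s (x *: v).
    apply: (idl_min (J := fun a => in_span s (a *: v)) _ _ sx) => [|y ys].
      split=> [|a b c hb hc]; first by rewrite scale0r; apply: submod0.
      by rewrite scalerDl -scalerA; apply: sM.2.
    exact: in_span_mem.
  apply: (in_span_sub (s := s)); first by move=> y ys; rewrite mem_rcons inE ys orbT.
  have := hs (size s) u; rewrite size_rcons ltnSn nth_rcons ltnn eqxx -cats1 take_size_cat //.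
  by apply.
have [s' s'max ss'] : exists2 s', maximal_regular_sequence J M s' & (size (rcons s x) <= size s')%N.
  apply: (IH (idl (rcons s x)) x) => //.
  - exact: ideal_span.
  - by rewrite -sK; apply: idl_sub => y ys; rewrite mem_rcons inE ys orbT.
  - by apply: mem_idl; rewrite mem_rcons mem_head.
  - by rewrite -sK.
  - by move=> y; rewrite mem_rcons inE => /predU1P[->|/sJ].
by exists s' => //; move: ss'; rewrite size_rcons; apply: ltnW.
Qed.

End RegularSequenceFacts.

(** * Passage between ideals as predicates and bundled ideals *)

Section IdealPredicates.
Variable A : comNzRingType.

Lemma idealr_ideal (I : idealr A) : ideal (fun a => a \in I).
Proof. by split=> [|a u v uI vI]; [apply: idealr0 | rewrite rpredD // idealMr]. Qed.

Lemma prime_idealr_pred (p : prime_idealr A) : prime_pred (fun a => a \in p).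
Proof.
split; [exact: idealr_ideal | by rewrite idealr1 |].
by move=> a b; rewrite prime_idealrM => /orP[]; [left | right].
Qed.

Lemma ideal_idealr (J : A -> Prop) : ideal J -> ~ J 1 ->
  exists I : idealr A, forall a, a \in I <-> J a.
Proof.
move=> Jid J1; pose I0 : A -> bool := fun a => `[< J a >].
have I0P : idealr_closed (I0 : {pred A}).
  split; first by apply/asboolP; apply: ideal0.
    by apply/negP => /asboolP.
  by move=> a u v /asboolP uJ /asboolP vJ; apply/asboolP; apply: Jid.2.
pose I0c := isIdealr.Build A I0 I0P.
pose I : idealr A := HB.pack I0 I0c.
by exists I => a; split=> [/asboolP|?]; last apply/asboolP.
Qed.

Lemma prime_pred_idealr (q : A -> Prop) : prime_pred q ->
  exists p : prime_idealr A, forall a, a \in p <-> q a.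
Proof.
move=> [qid q1 qM]; pose I0 : A -> bool := fun a => `[< q a >].
have I0P : idealr_closed (I0 : {pred A}).
  split; first by apply/asboolP; apply: ideal0.
    by apply/negP => /asboolP.
  by move=> a u v /asboolP uJ /asboolP vJ; apply/asboolP; apply: qid.2.
have I0M : prime_idealr_closed (I0 : {pred A}).
  by move=> u v /asboolP/qM[h|h]; apply/orP; [left | right]; apply/asboolP.
pose p1 := isIdealr.Build A I0 I0P.
pose p2 := isPrimeIdealrClosed.Build A I0 I0M.
pose p : prime_idealr A := HB.pack I0 p1 p2.
by exists p => a; split=> [/asboolP|?]; last apply/asboolP.
Qed.

End IdealPredicates.

(** * Local noetherian rings *)

Section Local.
Variables (A : comNzRingType) (m : idealr A).
Hypotheses (noethA : noetherian A) (mloc : local_ring m).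

Lemma local_unit a : a \notin m -> exists t, t * a = 1.
Proof.
move=> am; apply: contrapT => nu; case/negP: am.
(* A maximal ideal above K, by noetherian induction in place of Zorn's lemma. *)
have max_ex K : ideal K -> ~ K 1 -> exists2 n : idealr A, maximal_ideal n &
    forall b, K b -> b \in n.
  move: K; apply: (noetherian_ind noethA) => K Kid IH K1.
  have [[L [b [Lid L1 KL Lb Kb]]]|no] := pselect (exists L b,
      [/\ ideal L, ~ L 1, subideal K L, L b & ~ K b]).
    have [n nmax Ln] := IH L b Lid KL Lb Kb L1.
    by exists n => // c /KL/Ln.
  have [n nK] := ideal_idealr Kid K1; exists n; last by move=> b /nK.
  move=> J nJ b bJ; apply/nK; apply: contrapT => Kb; apply: no.
  exists (fun a => a \in J), b; split=> //; first exact: idealr_ideal.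
    by rewrite idealr1.
  by move=> c /nK/nJ.
have [||n nmax sn] := max_ex (fun b => exists t, b = t * a).
- split=> [|b u v [t ->] [t' ->]]; first by exists 0; rewrite mul0r.
  by exists (b * t + t'); rewrite mulrDl mulrA.
- by move=> [t ta]; apply: nu; exists t.
by rewrite -(mloc.2 n nmax); apply: sn; exists 1; rewrite mul1r.
Qed.

Lemma local_prime : prime_pred (fun a => a \in m).
Proof.
split; [exact: idealr_ideal | by rewrite idealr1 | move=> a b abm].
have [am|/local_unit[t ta]] := boolP (a \in m); [by left | right].
by rewrite -[b]mul1r -ta -mulrA idealMr.
Qed.

Lemma idealr_sub_local (I : idealr A) a : a \in I -> a \in m.
Proof.
move=> aI; apply: contraT => /local_unit[t ta].
by have := idealMr t aI; rewrite ta idealr1.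
Qed.

End Local.

Lemma regular_sequence_regulars (A : comNzRingType) (s : seq A) :
  regular_sequence A^o s -> regulars (fun a => a = 0) s.
Proof.
move=> [h _]; apply: regulars_nth => i si u; rewrite -idl_adjs; exact: h.
Qed.

(** * Translation of statements about A/I into statements about A *)

Section Quotient.
Variables (A : comNzRingType) (I : idealr A).
Local Notation Q := {ideal_quot I}.
Local Notation J := (fun a => a \in I).

Let piM a b : \pi_Q (a * b) = \pi_Q a * \pi_Q b. Proof. exact: rmorphM. Qed.
Let pi1 : \pi_Q 1 = 1. Proof. exact: rmorph1. Qed.
Let piB a b : \pi_Q (a - b) = \pi_Q a - \pi_Q b. Proof. exact: raddfB. Qed.
Let piD a b : \pi_Q (a + b) = \pi_Q a + \pi_Q b. Proof. exact: raddfD. Qed.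
Let pi0 : \pi_Q 0 = 0. Proof. exact: raddf0. Qed.

Lemma quot_pi0 a : \pi_Q a = 0 <-> a \in I.
Proof.
have -> : 0 = \pi_Q 0 :> Q by rewrite pi0.
by rewrite -[a in a \in I]subr0 Quotient.idealrBE; split=> /eqP.
Qed.

Lemma quot_span (s : seq Q) a :
  in_span s (\pi_Q a : Q^o) <-> adjs J (map repr s) a.
Proof.
elim/last_ind: s a => [|s z IH] a.
  split=> [/in_span_nil/quot_pi0//|/quot_pi0->]; exact: submod0 (submod_span _ _).
rewrite map_rcons adjs_rcons in_span_rcons.
have piE r : \pi_Q (a - r * repr z) = \pi_Q a - z * \pi_Q r.
  by rewrite piB piM reprK mulrC.
split=> [[v]|[r /IH]]; last by rewrite piE; exists (\pi_Q r).
by rewrite -[v]reprK -[_ *: _]/(_ * _) -piE => /IH; exists (repr v).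
Qed.

Lemma regular_sequence_quot (s : seq Q) :
  regular_sequence Q^o s -> regulars J (map repr s).
Proof.
move=> [h _]; apply: regulars_nth => i; rewrite size_map => si u.
rewrite -map_take (nth_map 0) // => /quot_span hu; apply/quot_span.
apply: h si _; move: hu; by rewrite piM reprK.
Qed.

(** Hence representatives of elements of the maximal ideal of A/I are nonunits, that is, they lie in
    m. *)
Lemma quot_idealr_lift (n : idealr Q) (z : Q) t : z \in n -> t * repr z <> 1.
Proof.
move=> zn tz; have := idealMr (\pi_Q t) zn.
have -> : \pi_Q t * z = 1 by rewrite -[z]reprK -piM tz pi1.
by rewrite idealr1.
Qed.

Lemma krull_dim_quot_ge k d (p : nat -> A -> Prop) : krull_dim Q d ->
  (forall i, (i <= k)%N -> prime_pred (p i)) -> subideal J (p 0%N) ->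
  (forall i, (i < k)%N -> subideal (p i) (p i.+1) /\ exists2 x, p i.+1 x & ~ p i x) ->
  (k <= d)%N.
Proof.
move=> [_ dmax] pP Ip pS.
have Ipi i : (i <= k)%N -> subideal J (p i).
  elim: i => // i IH ik a aI; apply: (pS i ik).1; exact: IH (ltnW ik) a aI.
have pQ i a b : (i <= k)%N -> \pi_Q a = \pi_Q b -> p i a -> p i b.
  move=> ik ab; have [pid _ _] := pP i ik; apply: (ideal_subr pid).
  by apply: (Ipi i ik); apply/quot_pi0; rewrite piB ab subrr.
(* A chain is a function on all of [nat], while [p] is prime only up to k; [minn] makes it constant
   beyond. *)
have qP i : exists q : prime_idealr Q, forall a, \pi_Q a \in q <-> p (minn i k) a.
  have ik := geq_minr i k; have [pid p1 pM] := pP _ ik.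
  have [|q qE] := @prime_pred_idealr Q (fun z => p (minn i k) (repr z)).
    split; first split=> [|z u v hu hv].
    - by apply: (pQ _ 0 _ ik); [rewrite reprK pi0 | apply: ideal0].
    - apply: (pQ _ (repr z * repr u + repr v) _ ik).
        by rewrite piD piM !reprK.
      exact: pid.2.
    - by move=> h; apply: p1; apply: (pQ _ _ _ ik) h; rewrite reprK pi1.
    - by move=> z w h; apply: pM; apply: (pQ _ _ _ ik) h; rewrite reprK piM !reprK.
  exists q => a; rewrite qE; split; apply: (pQ _ _ _ ik); by rewrite reprK.
pose q i := sval (cid (qP i)).
have qE i a : \pi_Q a \in q i <-> p (minn i k) a by rewrite /q; case: cid.
apply: (dmax k q) => i ik; have [sub [x px npx]] := pS i ik.
have e1 : minn i k = i by apply/minn_idPl/ltnW.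
have e2 : minn i.+1 k = i.+1 by apply/minn_idPl.
split=> [z|].
  by rewrite -[z]reprK => /qE; rewrite e1 => /sub pz; apply/qE; rewrite e2.
by exists (\pi_Q x); [apply/qE; rewrite e2 | apply/negP => /qE; rewrite e1].
Qed.

End Quotient.

(** * Injective resolutions and the vanishing of Ext *)

Section Resolution.
Variables (A : comNzRingType) (E : nat -> lmodType A).
Variables (d : forall i, {linear E i -> E i.+1}) (e0 : E 1).
Hypotheses (noethA : noetherian A) (injE : forall i, injective_module (E i)).
(** With a zero module in front, degree-0 coboundaries need no separate definition: they are 0. *)
Hypothesis E0 : forall u : E 0, u = 0.
Hypothesis dd : forall i (u : E i), d i.+1 (d i u) = 0.
Hypothesis exactE : forall i (v : E i.+2), d i.+2 v = 0 -> exists u, v = d i.+1 u.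
Hypothesis exactE0 : forall v : E 1, d 1 v = 0 <-> exists a, v = a *: e0.
Hypothesis e0_free : forall a, a *: e0 = 0 -> a = 0.

Let dZ i a (u : E i) : d i (a *: u) = a *: d i u. Proof. exact: linearZ. Qed.
Let dB i (u v : E i) : d i (u - v) = d i u - d i v. Proof. exact: linearB. Qed.
Let d0 i : d i 0 = 0. Proof. exact: linear0. Qed.

(* The cohomology of the complex of [J]-torsion elements of [E] is [Ext(A/J, A)];
   the degree of [Ext] is one less than the index of the module containing the
   cocycles, as [E 0 = 0]. *)
Definition cocycle i (J : A -> Prop) (w : E i.+1) : Prop := kills J w /\ d i.+1 w = 0.
Definition coboundary i (J : A -> Prop) (w : E i.+1) : Prop :=
  exists2 v : E i, kills J v & w = d i v.

Lemma submod_kills i J : submod (@kills A (E i) J).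
Proof.
split=> [a _|a u v uJ vJ b Jb]; first by rewrite scaler0.
by rewrite scalerDr scalerA mulrC -scalerA uJ // vJ // scaler0 addr0.
Qed.
Arguments submod_kills {i J}.

Lemma submod_cocycle i J : submod (@cocycle i J).
Proof.
split=> [|a u v [uJ du] [vJ dv]].
  by split; [apply: submod_kills.1 | rewrite d0].
by split; [apply: submod_kills.2 | rewrite linearP du dv scaler0 addr0].
Qed.
Arguments submod_cocycle {i J}.

Lemma submod_coboundary i J : submod (@coboundary i J).
Proof.
split=> [|a u v [u' uJ ->] [v' vJ ->]].
  by exists 0; [apply: submod_kills.1 | rewrite d0].
by exists (a *: u' + v'); [apply: submod_kills.2 | rewrite linearP].
Qed.
Arguments submod_coboundary {i J}.

Lemma kills_sub i J K (v : E i) : subideal J K -> kills K v -> kills J v.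
Proof. by move=> JK vK a /JK; apply: vK. Qed.

Lemma coboundary_sub i J K (w : E i.+1) :
  subideal J K -> coboundary K w -> coboundary J w.
Proof. by move=> JK [v vK ->]; exists v => //; apply: kills_sub vK. Qed.

Lemma cocycle_sub i J K (w : E i.+1) : subideal J K -> cocycle K w -> cocycle J w.
Proof. by move=> JK [wK dw]; split=> //; apply: kills_sub wK. Qed.

Lemma coboundary_cocycle i J (w : E i.+1) : coboundary J w -> cocycle J w.
Proof.
by move=> [v vJ ->]; split; [move=> a Ja; rewrite -dZ vJ ?d0 | apply: dd].
Qed.

Lemma kills_adj i J x (v : E i) : kills J v -> x *: v = 0 -> kills (adj J x) v.
Proof.
move=> vJ xv a [r /vJ]; rewrite scalerBl -scalerA xv scaler0 subr0; exact.
Qed.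

Lemma kills_colon i J a (v : E i) : kills J v -> kills (colon J a) (a *: v).
Proof. by move=> vJ b Jba; rewrite scalerA vJ. Qed.

(** A tuple h is a map from A^n to E i, and [mact P h] its values on the rows of P; it vanishes when
    h factors through A^n / rowspace P. *)
Definition mact i k n (P : 'M[A]_(k, n)) (h : 'I_n -> E i) : 'I_k -> E i :=
  fun a => \sum_j P a j *: h j.

Lemma mactM i l k n (Q : 'M_(l, k)) (P : 'M_(k, n)) (h : 'I_n -> E i) a :
  mact Q (mact P h) a = mact (Q *m P) h a.
Proof.
rewrite /mact; under eq_bigr do rewrite scaler_sumr.
rewrite exchange_big; apply: eq_bigr => j _; rewrite mxE scaler_suml.
by apply: eq_bigr => b _; rewrite scalerA.
Qed.

Lemma mact_d i k n (P : 'M_(k, n)) (h : 'I_n -> E i) a :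
  mact P (fun j => d i (h j)) a = d i (mact P h a).
Proof. by rewrite /mact linear_sum; apply: eq_bigr => j _; rewrite dZ. Qed.

Lemma mact_eq i k n (P : 'M_(k, n)) (h h' : 'I_n -> E i) a :
  h =1 h' -> mact P h a = mact P h' a.
Proof. by move=> hh; apply: eq_bigr => j _; rewrite hh. Qed.

Lemma mact0 i k n (P : 'M_(k, n)) a : mact P (fun=> 0 : E i) a = 0.
Proof. by rewrite /mact big1 // => j _; rewrite scaler0. Qed.

(* Ext(A^n / rowspace P, A) is finitely generated, by dimension shifting along a
   presentation of the row space of P. *)
Lemma ext_fg i k n (P : 'M[A]_(k, n)) :
  exists N (G : 'I_N -> 'I_n -> E i.+1),
    (forall a, (forall b, mact P (G a) b = 0) /\ forall j, d i.+1 (G a j) = 0) /\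
    forall f : 'I_n -> E i.+1,
      (forall b, mact P f b = 0) -> (forall j, d i.+1 (f j) = 0) ->
      exists c : 'I_N -> A, exists2 th : 'I_n -> E i,
        forall b, mact P th b = 0 & forall j, f j - \sum_a c a *: G a j = d i (th j).
Proof.
elim: i k n P => [|i IH] k n P.
  have Lsub : submod (fun c : 'rV_n => P *m c^T = 0).
    split=> [|a u v hu hv]; first by rewrite trmx0 mulmx0.
    by rewrite linearP mulmxDr -scalemxAr hu hv scaler0 addr0.
  have [l [Q [QP Qgen]]] := fg_row_submod noethA Lsub.
  exists l, (fun a j => Q a j *: e0); split=> [a|f Pf df].
    split=> [b|j]; last by apply/exactE0; exists (Q a j).
    rewrite /mact; under eq_bigr do rewrite scalerA.
    rewrite -scaler_suml; have /matrixP/(_ b 0) := QP a; rewrite !mxE.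
    under eq_bigr do rewrite !mxE.
    by move->; rewrite scale0r.
  have cP j : exists a, f j = a *: e0 by apply/exactE0.
  pose c := \row_j sval (cid (cP j)).
  have fc j : f j = c 0 j *: e0 by rewrite mxE; case: cid.
  have [|r cr] := Qgen c.
    apply/matrixP => b j'; rewrite !mxE; apply: e0_free; rewrite -(Pf b) scaler_suml.
    by apply: eq_bigr => j _; rewrite fc scalerA [c^T _ _]mxE ord1.
  exists (r 0); exists (fun=> 0) => [b|j]; first exact: mact0.
  rewrite d0 fc cr mxE scaler_suml -sumrB big1 // => a _.
  by rewrite scalerA subrr.
have Lsub : submod (fun c : 'rV_k => c *m P = 0).
  split=> [|a u v hu hv]; first by rewrite mul0mx.
  by rewrite mulmxDl -scalemxAl hu hv scaler0 addr0.
have [l [Q [QP Qgen]]] := fg_row_submod noethA Lsub.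
have QP0 : Q *m P = 0 by apply/row_matrixP => a; rewrite row_mul QP row0.
have solve j (g : 'I_k -> E j) : (forall b, mact Q g b = 0) ->
    exists h : 'I_n -> E j, forall b, mact P h b = g b.
  move=> Qg; apply: injective_solve => // c /Qgen[r ->].
  have {1}-> : \sum_a (r *m Q) 0 a *: g a = mact r (mact Q g) 0 by rewrite mactM.
  by rewrite (@mact_eq _ _ _ _ _ (fun=> 0)) // mact0.
have [N [G [GZ Ggen]]] := IH _ _ Q.
have HP a : exists h : 'I_n -> E i.+1, forall b, mact P h b = G a b.
  by apply: solve => b; apply: (GZ a).1.
pose H a := sval (cid (HP a)).
have HE a b : mact P (H a) b = G a b by rewrite /H; case: cid.
exists N, (fun a j => d i.+1 (H a j)); split=> [a|f Pf df].
  by split=> [b|j]; [rewrite mact_d HE (GZ a).2 | rewrite dd].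
have hP j : exists h, f j = d i.+1 h by apply: exactE.
pose h j := sval (cid (hP j)).
have fh j : f j = d i.+1 (h j) by rewrite /h; case: cid.
have [b|j|c [th Qth thE]] := Ggen (mact P h).
- by rewrite mactM QP0 /mact big1 // => a _; rewrite mxE scale0r.
- by rewrite -mact_d -(mact_eq P j fh).
(* Restricted to the rows of P, h agrees with the combination of the [H a] up to d [th]; extending
   [th] to [sg] removes this defect without changing the class. *)
have [sg sgE] := solve _ th Qth.
exists c; exists (fun j => h j - \sum_a c a *: H a j - d i (sg j)) => [b|j].
  transitivity (mact P h b - \sum_a c a *: mact P (H a) b - mact P (fun j => d i (sg j)) b).
    rewrite /mact; under eq_bigr do rewrite !scalerBr.
    rewrite !sumrB; congr (_ - _ - _).
    under eq_bigr do rewrite scaler_sumr; rewrite exchange_big.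
    apply: eq_bigr => a _; rewrite scaler_sumr; apply: eq_bigr => j _.
    by rewrite !scalerA mulrC.
  under eq_bigr do rewrite HE; rewrite thE mact_d sgE subrr //.
rewrite !dB dd subr0 -fh; congr (_ - _); rewrite linear_sum.
by apply: eq_bigr => a _; rewrite dZ.
Qed.

(** Ext^i(A/J, A) localized at q is zero, expressed class by class. *)
Definition null (q : A -> Prop) i (J : A -> Prop) : Prop :=
  forall w : E i.+1, cocycle J w -> exists2 s, ~ q s & coboundary J (s *: w).

(** The hypothesis says that, locally at q, Ext^i(A/J, A) equals x times itself; it is finitely
    generated by [ext_fg], with the column of generators of J as presentation. *)
Lemma null_nakayama (q : A -> Prop) i J x : prime_pred q -> q x -> ideal J ->
  (forall w : E i.+1, cocycle J w -> exists2 s, ~ q s &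
     exists2 w', cocycle J w' & coboundary J (s *: w - x *: w')) ->
  null q i J.
Proof.
move=> qP qx Jid h; have [qid _ _] := qP.
have [s sJ] := noetherian_fg noethA Jid.
pose P : 'cV[A]_(size s) := \col_b s`_b.
have killsP k (v : E k) : kills J v <-> forall b, mact P (fun=> v) b = 0.
  have mactP b : mact P (fun=> v) b = s`_b *: v by rewrite /mact big_ord1 mxE.
  split=> [vJ b|Pv a /sJ[c ->]].
    by rewrite mactP; apply/vJ/sJ/mem_idl/mem_nth.
  rewrite scaler_suml big1 // => b _.
  by rewrite -[_ *: c b]/(_ * c b) mulrC -scalerA -mactP Pv scaler0.
have [N [G [GZ Ggen]]] := ext_fg i P.
pose w a := if insub a is Some b then G b 0 else 0.
have wE (b : 'I_N) : w b = G b 0 by rewrite /w valK.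
have wZ a : cocycle J (w a).
  rewrite /w; case: insubP => [b _ _|_]; last exact: submod_cocycle.1.
  have [Pb db] := GZ b; split; last exact: db.
  by apply/killsP => c; rewrite -[RHS](Pb c); apply: mact_eq => j; rewrite ord1.
have gen u : cocycle J u -> exists c : nat -> A, coboundary J (u - \sum_(b < N) c b *: w b).
  move=> [uJ du]; have [||c [th Pth thE]] := Ggen (fun=> u); first exact/killsP.
    by [].
  exists (fun b => if insub b is Some b' then c b' else 0); exists (th 0).
    by apply/killsP => b; rewrite -[RHS](Pth b); apply: mact_eq => j; rewrite ord1.
  rewrite -thE; congr (_ - _); apply: eq_bigr => b _.
  by rewrite valK wE.
have [|t tq tB] := nakayama (@submod_coboundary i J) qP (N := N) (w := w).
  move=> a aN; have [t tq [w' w'Z hB]] := h _ (wZ a); exists t => //.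
  have [c cB] := gen _ w'Z; exists (fun b => x * c b).
    by move=> b; apply: (idealM qid).
  under eq_bigr do rewrite -scalerA.
  rewrite -scaler_sumr.
  have := submodD submod_coboundary hB (submodZ submod_coboundary x cB).
  by rewrite scalerBr addrA subrK.
move=> u /gen[c cB]; exists t => //.
apply: (submod_subl submod_coboundary (v := t *: \sum_(b < N) c b *: w b)).
  by rewrite -scalerBr; apply: submodZ => //; apply: submod_coboundary.
rewrite scaler_sumr; apply: submod_sum => [|b _]; first exact: submod_coboundary.
rewrite scalerA mulrC -scalerA; apply: submodZ; first exact: submod_coboundary.
exact: tB.
Qed.

Definition ext0 i (J : A -> Prop) : Prop :=
  forall w : E i.+1, cocycle J w -> coboundary J w.

(** From 0 -> A/(J : a) -> A/J -> A/(J + (a)) -> 0: an element whose restriction to A/(J : a) bounds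
    comes, up to a coboundary, from A/(J + (a)). *)
Lemma kills_adj_correct i J a (w : E i.+1) : ideal J -> kills J w ->
  coboundary (colon J a) (a *: w) ->
  exists2 w' : E i.+1, kills (adj J a) w' & coboundary J (w - w').
Proof.
move=> Jid wJ [th thK aw].
have [th' th'J ath'] := injective_divide (@injE i) noethA Jid thK.
exists (w - d i th'); last by exists th'; rewrite // opprB addrCA subrr addr0.
apply: kills_adj; last by rewrite scalerBr aw -ath' dZ subrr.
apply: (submodB submod_kills) => // b Jb.
by rewrite -dZ th'J // d0.
Qed.

Lemma cocycle_adj_correct i J a (w : E i.+1) : ideal J -> cocycle J w ->
  coboundary (colon J a) (a *: w) ->
  exists2 w' : E i.+1, cocycle (adj J a) w' & coboundary J (w - w').
Proof.
move=> Jid [wJ dw] /(kills_adj_correct Jid wJ)[w' w'J ww'].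
exists w' => //; split=> //; have [_] := coboundary_cocycle ww'.
by rewrite dB dw sub0r => /eqP; rewrite oppr_eq0 => /eqP.
Qed.

Lemma divide_regular i J x (v : E i) : ideal J -> regular J x -> kills J v ->
  exists2 v' : E i, kills J v' & x *: v' = v.
Proof.
move=> Jid xJ vJ; apply: (injective_divide (@injE i) noethA Jid).
by move=> r rx; apply: vJ; apply: xJ; rewrite mulrC.
Qed.

Lemma cocycle_d i J x (v : E i.+1) : kills J v -> x *: d i.+1 v = 0 ->
  cocycle (adj J x) (d i.+1 v).
Proof.
move=> vJ xv; split; last exact: dd.
by apply: kills_adj => // a Ja; rewrite -dZ vJ // d0.
Qed.

(* What Ext knows about an ideal S generated by a regular sequence of length c:
   Ext(A/S, A) is concentrated in degree c, where it is free over A/S on the class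
   of eps, and Ext^i(A/J, A) = 0 for i < c and J containing S. *)
Definition ext_free c (S : A -> Prop) (eps : E c.+1) : Prop :=
  [/\ ideal S, cocycle S eps,
      forall w, cocycle S w -> exists b, coboundary S (w - b *: eps),
      forall b, coboundary S (b *: eps) <-> S b &
      (forall i, (c < i)%N -> ext0 i S) /\
      (forall J i, ideal J -> subideal S J -> (i < c)%N -> ext0 i J)].

Lemma ext_free0 : @ext_free 0 (fun a => a = 0) e0.
Proof.
have Sid : ideal (fun a : A => a = 0).
  by split=> // a u v -> ->; rewrite mulr0 addr0.
have all0 i (v : E i) : kills (fun a : A => a = 0) v by move=> a ->; rewrite scale0r.
split=> // [|w [_ /exactE0[b ->]]|b|].
- by split=> //; apply/exactE0; exists 1; rewrite scale1r.
- by exists b; exists 0; rewrite ?subrr ?d0.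
- split=> [[v _ /eqP]|->]; last by exists 0; rewrite ?scale0r ?d0.
  by rewrite (E0 v) d0 => /eqP/e0_free.
- by split=> // -[//|i] _ w [_ /exactE[v ->]]; exists v.
Qed.

Section ExtFree.
Variables (c : nat) (S : A -> Prop) (eps : E c.+1).
Hypothesis epsF : ext_free S eps.
Let Sid : ideal S. Proof. by case: epsF. Qed.

(** Injectivity of Ext^c(A/J, A) -> Ext^c(A/S, A), one generator of J at a time; what could obstruct
    it lies in Ext^(c-1), which vanishes. *)
Lemma ext_free_inj J (w : E c.+1) : ideal J -> subideal S J ->
  cocycle J w -> coboundary S w -> coboundary J w.
Proof.
move=> Jid SJ; case: (epsF) => _ _ _ _ [_ below]; case: c below w => [|c'] below w.
  move=> _ [v _ ->]; exists 0; last by rewrite (E0 v).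
  exact: submod_kills.1.
move=> [wJ dw] wS; apply: (adjoin_ind noethA (P := fun K => coboundary K w) Sid Jid) => //.
move=> K j Kid SK KJ Jj [th thK wth].
have [|th' th'K [u uK]] := kills_adj_correct Kid thK (a := j).
  apply: (below _ _ (ideal_colon Kid j)) => // [a /SK|].
    exact: subideal_colon.
  by split; [apply: kills_colon | rewrite dZ -wth wJ].
move=> thth'; exists th' => //; apply/eqP; rewrite wth -subr_eq0 -dB thth' dd //.
Qed.

(** Inside Ext^c(A/S, A) = A/S, the classes coming from A/J include (S : J)/S. *)
Lemma ext_free_lift J a : ideal J -> subideal S J -> (forall j, J j -> S (a * j)) ->
  exists2 w, cocycle J w & coboundary S (w - a *: eps).
Proof.
move=> Jid SJ aJ; have [_ epsZ gen epsS _] := epsF.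
apply: (adjoin_ind noethA (P := fun K => exists2 w, cocycle K w &
  coboundary S (w - a *: eps)) Sid Jid) => //.
  exists (a *: eps); first exact: (submodZ submod_cocycle).
  by rewrite subrr; apply: (submod0 submod_coboundary).
move=> K j Kid SK KJ Jj [w wK wa].
have jwK : cocycle (colon K j) (j *: w).
  by case: wK => wK dw; split; [apply: kills_colon | rewrite dZ dw scaler0].
have [|w' w'K ww'] := cocycle_adj_correct Kid wK (a := j).
  (* Over S the cocycle j w has class a j eps, which is zero as a j lies in S. *)
  apply: ext_free_inj (ideal_colon Kid j) _ jwK _.
    by move=> b /SK; apply: subideal_colon.
  apply: (submod_subl submod_coboundary (v := (a * j) *: eps)); last exact/epsS/aJ.
  by rewrite mulrC -scalerA -scalerBr; apply: (submodZ submod_coboundary).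
exists w' => //; apply: (submod_subr submod_coboundary (u := w - a *: eps)) => //.
rewrite opprB addrA subrK.
exact: coboundary_sub ww'.
Qed.

Variable z : A.
Hypothesis zreg : regular S z.

(** On Ext^c(A/S, A) = A/S multiplication by z is injective with cokernel A/(S + (z)). The
    connecting map sends this cokernel onto Ext^(c+1)(A/(S + (z)), A), and [d eta] with z eta = eps
    is its value at eps. *)
Lemma ext_free_adj : exists eta : E c.+1,
  [/\ kills S eta, z *: eta = eps & ext_free (adj S z) (d c.+1 eta)].
Proof.
have [_ epsZ gen epsS [above below]] := epsF.
have [eta etaS zeta] := divide_regular Sid zreg epsZ.1.
have Sz := ideal_adj Sid z; have SSz := @subideal_adj A S z.
have etaZ : cocycle (adj S z) (d c.+1 eta).
  by apply: cocycle_d => //; rewrite -dZ zeta epsZ.2.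
have class (rho : E c.+1) : kills S rho -> z *: d c.+1 rho = 0 -> exists b,
    coboundary (adj S z) (d c.+1 rho - b *: d c.+1 eta).
  move=> rhoS zrho; have [|b [tau tauS bE]] := gen (z *: rho).
    split; last by rewrite dZ.
    exact: (submodZ submod_kills).
  have [tau' tau'S ztau] := divide_regular Sid zreg tauS.
  exists b; exists (rho - b *: eta - d c tau'); last first.
    by rewrite !dB dd subr0 dZ.
  apply: kills_adj; last first.
    by rewrite !scalerBr scalerA mulrC -scalerA zeta bE -dZ ztau subrr.
  apply: (submodB submod_kills); first apply: (submodB submod_kills) => //.
    exact: (submodZ submod_kills).
  by have [] := coboundary_cocycle (ex_intro2 _ _ tau' tau'S erefl).
exists eta; split=> //; split=> //.
- move=> w [wSz dw]; have [|rho rhoS wE] := above _ (ltnSn c) w.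
    by split=> //; apply: kills_sub wSz.
  by rewrite wE; apply: class => //; rewrite -wE; apply/wSz/mem_adj.
- move=> b; split=> [[th thSz bE]|[r Sbr]].
    have [|a [tau tauS aE]] := gen (b *: eta - th).
      split; last by rewrite dB dZ bE subrr.
      apply: (submodB submod_kills); first exact: (submodZ submod_kills).
      exact: kills_sub thSz.
    exists a; apply/epsS; exists (z *: tau); first exact: (submodZ submod_kills).
    rewrite dZ -aE !scalerBr thSz; last exact: mem_adj.
    by rewrite subr0 scalerBl [a * z]mulrC !scalerA [z * b]mulrC -(scalerA b) zeta.
  have [tau tauS brE] := (epsS _).2 Sbr.
  have [tau' tau'S ztau] := divide_regular Sid zreg tauS.
  exists (b *: eta - r *: eps - d c tau'); last first.
    by rewrite !dB dd subr0 !dZ epsZ.2 scaler0 subr0.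
  apply: kills_adj; last first.
    rewrite !scalerBr -dZ ztau -brE !scalerA [z * b]mulrC -(scalerA b) zeta.
    by rewrite scalerBl [z * r]mulrC subrr.
  have [? _] := epsZ.
  apply: (submodB submod_kills); first apply: (submodB submod_kills).
  + exact: (submodZ submod_kills).
  + exact: (submodZ submod_kills).
  by have [] := coboundary_cocycle (ex_intro2 _ _ tau' tau'S erefl).
- split=> [[//|i] ci w [wSz dw]|J i Jid SzJ].
    have [|rho rhoS wE] := above _ (ltnW ci) w.
      by split=> //; apply: kills_sub wSz.
    have [|tau tauS tauE] := above _ ci (z *: rho).
      split; first exact: (submodZ submod_kills).
      by rewrite dZ -wE; apply/wSz/mem_adj.
    have [tau' tau'S ztau] := divide_regular Sid zreg tauS.
    exists (rho - d i tau'); last by rewrite dB dd subr0.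
    apply: kills_adj; last by rewrite scalerBr tauE -ztau dZ subrr.
    apply: (submodB submod_kills) => //.
    by have [] := coboundary_cocycle (ex_intro2 _ _ tau' tau'S erefl).
  have SJ a : S a -> J a by move/(SSz a)/SzJ.
  rewrite ltnS leq_eqVlt => /predU1P[->|]; last exact: below.
  (* In degree c, a class killed by z injects into A/S, where z is regular. *)
  move=> w wJ; apply: ext_free_inj => //.
  have [b bS] := gen _ (cocycle_sub SJ wJ).
  apply: (submod_subl submod_coboundary bS); apply/epsS/zreg/epsS.
  have := submodZ submod_coboundary z bS.
  rewrite scalerBr scalerA wJ.1; last exact/SzJ/mem_adj.
  rewrite sub0r -scaleN1r => /(submodZ submod_coboundary (-1)).
  by rewrite scalerA mulN1r opprK scale1r.
Qed.

End ExtFree.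

(** The element a gives a class w of degree c + 1 over A/(J + (z)). By vanishing over A/J, w = d rho
    with rho killed by J; then z rho is a cocycle over A/J, and its class over S is the required
    b. *)
Lemma ext_free_colon c S (eps : E c.+1) z J a : ext_free S eps -> regular S z ->
  ideal J -> subideal S J -> ext0 c.+1 J ->
  (forall j, J j -> adj S z (a * j)) ->
  exists2 b, forall j, J j -> S (b * j) & adj S z (a - b).
Proof.
move=> epsF zreg Jid SJ J0 aJ; have [Sid epsZ gen epsS _] := epsF.
have [eta [etaS zeta epsF']] := ext_free_adj epsF zreg.
have Sz := ideal_adj Sid z.
have [|||w wJz [th thSz wE]] := ext_free_lift epsF' (J := adj J z) (a := a).
- exact: ideal_adj.
- move=> b [r /SJ]; by exists r.
- move=> j [r Jj]; rewrite -[j](subrK (r * z)) mulrDr; apply: (idealD Sz).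
    exact: aJ.
  by rewrite mulrA; apply: (idealMl Sz); apply: mem_adj.
have [|rho rhoJ rhoE] := J0 w; first by apply: cocycle_sub wJz; apply: subideal_adj.
have zrhoJ : cocycle J (z *: rho).
  split; first exact: (submodZ submod_kills).
  by rewrite dZ -rhoE; apply/wJz.1/mem_adj.
have [b bS] := gen _ (cocycle_sub SJ zrhoJ).
exists b => [j Jj|].
  apply/epsS; have := submodZ submod_coboundary j bS.
  rewrite scalerBr scalerA mulrC [j *: _]zrhoJ.1 // sub0r mulrC => h.
  have := submodN submod_coboundary h; by rewrite opprK.
have thS : kills S th by apply: kills_sub thSz; apply: subideal_adj.
(* This difference is a cocycle over S of class r; multiplying by z, which kills [th], compares b
   with a + r z. *)
have [|r rS] := gen (rho - a *: eta - th).
  split; last by rewrite !dB dZ -rhoE -wE subrr.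
  apply: (submodB submod_kills) => //; apply: (submodB submod_kills).
    exact: kills_sub rhoJ.
  exact: (submodZ submod_kills).
exists (- r); rewrite mulNr opprK; apply/epsS.
have := submodB submod_coboundary bS (submodZ submod_coboundary z rS).
rewrite !scalerBr thSz ?subr0; last exact: mem_adj.
rewrite !scalerA [z * a]mulrC -(scalerA a) zeta !opprB.
rewrite scalerDl scalerBl [r * z]mulrC; congr coboundary.
by rewrite [_ + (a *: eps - _)]addrC addrA; congr (_ + _); rewrite addrC addrA subrK.
Qed.

(** Vanishing for A/(J + (x)) one degree up makes x surjective on Ext^i(A/J, A) at q. *)
Lemma null_regular (q : A -> Prop) i J x : prime_pred q -> q x -> ideal J ->
  regular J x -> null q i.+1 (adj J x) -> null q i J.
Proof.
move=> qP qx Jid xreg h; apply: (null_nakayama qP qx Jid) => w wJ.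
have [eta etaJ xeta] := divide_regular Jid xreg wJ.1.
have [|s sq [th thJx thE]] := h (d i.+1 eta).
  by apply: cocycle_d => //; rewrite -dZ xeta wJ.2.
exists s => //; exists (s *: eta - th).
  split; last by rewrite dB dZ thE subrr.
  apply: (submodB submod_kills); first exact: (submodZ submod_kills).
  by apply: kills_sub thJx; apply: subideal_adj.
rewrite scalerBr thJx; last exact: mem_adj.
rewrite subr0 -xeta !scalerA mulrC subrr; exact: (submod0 submod_coboundary).
Qed.

Lemma null_split (q : A -> Prop) i J a : prime_pred q -> ideal J ->
  null q i (colon J a) -> null q i (adj J a) -> null q i J.
Proof.
move=> [_ _ qM] Jid hc ha w [wJ dw].
have [|s sq sB] := hc (a *: w); first by split; [apply: kills_colon | rewrite dZ dw scaler0].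
have [||w' w'J ww'] := cocycle_adj_correct Jid (a := a) (w := s *: w).
- by split; [apply: (submodZ submod_kills) | rewrite dZ dw scaler0].
- by rewrite scalerA mulrC -scalerA.
have [t tq tB] := ha w' w'J; exists (t * s) => [/qM[]//|].
rewrite -scalerA; apply: (submod_subl submod_coboundary (v := t *: w')).
  by rewrite -scalerBr; apply: (submodZ submod_coboundary).
by apply: coboundary_sub tB; apply: subideal_adj.
Qed.

(** A maximal counterexample J is a prime inside q: otherwise an element outside q kills everything,
    or [null_split] reduces to larger ideals. Unless J = q, some x in q is regular on A/J. *)
Lemma null_step (q : A -> Prop) i : prime_pred q ->
  (forall J, ideal J -> null q i.+1 J) -> null q i q ->
  forall J, ideal J -> null q i J.
Proof.
move=> qP h hq; have [qid q1 qM] := qP.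
apply: (noetherian_ind noethA) => J Jid IH.
have [[a Ja qa]|Jq] := pselect (exists2 a, J a & ~ q a).
  move=> w [wJ _]; exists a; rewrite // wJ //; exact: (submod0 submod_coboundary).
have {}Jq a : J a -> q a by move=> Ja; apply: contrapT => qa; apply: Jq; exists a.
have [[x qx Jx]|qJ] := pselect (exists2 x, q x & ~ J x); last first.
  have -> // : J = q; apply: pred_ext => a; split=> [/Jq//|qa].
  by apply: contrapT => Ja; apply: qJ; exists a.
have [[a [b [Jab Ja Jb]]]|Jprime] := pselect (exists a b, [/\ J (a * b), ~ J a & ~ J b]).
  apply: (null_split (a := a) qP Jid).
    apply: (IH _ b (ideal_colon Jid a) (@subideal_colon _ _ Jid a)) => //.
    by rewrite /colon mulrC.
  by apply: (IH _ a (ideal_adj Jid a) (@subideal_adj _ J a)) => //; apply: mem_adj.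
apply: (null_regular qP qx Jid) => [u Jxu|]; last exact: h (ideal_adj Jid x).
by apply: contrapT => Ju; apply: Jprime; exists x, u.
Qed.

(** As q = S : u, there is 0 -> A/q -> A/S -> A/(S + (u)) -> 0, and Ext^i(A/S, A) = 0 for i > c. *)
Lemma null_socle (q : A -> Prop) i c S (eps : E c.+1) u : ext_free S eps ->
  (c < i)%N -> (forall a, q a <-> S (a * u)) -> null q i.+1 (adj S u) -> null q i q.
Proof.
move=> [Sid _ _ _ [above _]] ci qS h w [wq dw].
have [|w' w'S uw'] := injective_divide (@injE i.+1) noethA Sid (a := u) (f := w).
  by move=> a /qS; apply: wq.
have [|s sq [f fSu fE]] := h (d i.+1 w').
  by apply: cocycle_d => //; rewrite -dZ uw'.
have [|g gS gE] := above _ ci (s *: w' - f).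
  split; last by rewrite dB dZ fE subrr.
  apply: (submodB submod_kills); first exact: (submodZ submod_kills).
  by apply: kills_sub fSu; apply: subideal_adj.
exists s => //; exists (u *: g).
  by move=> a /qS aq; rewrite scalerA gS.
rewrite dZ -gE scalerBr fSu; last exact: mem_adj.
by rewrite subr0 scalerA mulrC -scalerA uw'.
Qed.

(** * Finite injective dimension: vanishing above the depth, and dim A at most the depth *)

Section FiniteInjectiveDimension.
Variable n : nat.
Hypothesis Etop : forall i, (n < i)%N -> forall u : E i, u = 0.

Lemma null_above_depth (q : A -> Prop) c S (eps : E c.+1) u : ext_free S eps ->
  prime_pred q -> (forall a, q a <-> S (a * u)) ->
  forall i J, (c < i)%N -> ideal J -> null q i J.
Proof.
move=> epsF qP qS i J ci; move: J; have [k] := ubnP (n - i).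
elim: k i ci => // k IH i ci ik J Jid.
(* Descending induction on i, starting where the resolution has ended. *)
have [ni|ni] := leqP n i.
  move=> w _; exists 1; first by case: qP.
  by exists 0; [apply: (submod0 submod_kills) | rewrite d0; apply: Etop].
have IH' K : ideal K -> null q i.+1 K by apply: IH; lia.
apply: null_step => // {J Jid}; apply: (null_socle epsF ci qS).
by apply: IH'; apply: ideal_adj; case: epsF.
Qed.

(** Each strict inclusion of primes lowers the vanishing range by one degree: x in q outside p is
    regular on A/p. *)
Lemma null_below (p q : A -> Prop) i x : prime_pred p -> prime_pred q ->
  subideal p q -> q x -> ~ p x ->
  (forall J, ideal J -> null q i.+1 J) -> forall J, ideal J -> null p i J.
Proof.
move=> pP qP pq qx px h; have [pid p1 pM] := pP.
have np j J : null q j J -> null p j J.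
  by move=> hJ w /hJ[s sq sB]; exists s => // /pq.
apply: null_step => // [J /h/np //|]; apply: np.
apply: (null_regular qP qx pid) => [u /pM[]//|]; exact: h (ideal_adj pid x).
Qed.

Lemma prime_chain_bound k c (p : nat -> A -> Prop) :
  (forall i, (i <= k)%N -> prime_pred (p i)) ->
  (forall i, (i < k)%N -> subideal (p i) (p i.+1) /\ exists2 x, p i.+1 x & ~ p i x) ->
  (forall i J, (c < i)%N -> ideal J -> null (p k) i J) -> (k <= c)%N.
Proof.
move=> pP pS h; rewrite leqNgt; apply/negP => ck.
have {}h j : (j <= k)%N -> forall i J, (c < i + j)%N -> ideal J -> null (p (k - j)%N) i J.
  elim: j => [_ i J|j IH jk i J ci]; first by rewrite addn0 subn0; apply: h.
  have [|sub [x px npx]] := pS (k - j.+1)%N; first by lia.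
  move: sub px; rewrite -subSn // subSS => sub px.
  apply: (null_below (pP _ _) (pP _ _) sub px npx); [lia|lia|].
  by move=> K; apply: IH; lia.
have [Sid epsZ _ epsS _] := ext_free0.
(* After c + 1 steps down the chain, Ext^0(A, A) = A would vanish at a prime. *)
have [|s sp /epsS s0] := h c.+1 ck 0%N _ _ Sid e0 epsZ; first by lia.
have [|pid _ _] := pP (k - c.+1)%N; first by lia.
by apply: sp; rewrite s0; apply: ideal0.
Qed.

End FiniteInjectiveDimension.

Lemma null_depth_ge (m : A -> Prop) c : prime_pred m ->
  (forall i J, (c < i)%N -> ideal J -> null m i J) ->
  forall k J i, ideal J -> depth_ge m J k -> (c < i + k)%N -> null m i J.
Proof.
move=> mP h; elim=> [|k IH] J i Jid; first by rewrite addn0 => _ ci; apply: h.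
move=> [x [mx xreg xk]] ci; apply: (null_regular mP mx Jid xreg).
by apply: IH => //; [apply: ideal_adj | rewrite addSnnS].
Qed.

Lemma null_ext0 (m : A -> Prop) i J : (forall s, ~ m s -> exists t, t * s = 1) ->
  null m i J -> ext0 i J.
Proof.
move=> mU h w /h[s /mU[t ts] sB].
by rewrite -[w]scale1r -ts -scalerA; apply: (submodZ submod_coboundary).
Qed.

(** [c'] is a variable, equal to [c + size s] only propositionally, because the type of [eps']
    depends on it. *)
Lemma ext_free_adjs c S (eps : E c.+1) s : ext_free S eps -> regulars S s ->
  exists c', c' = (c + size s)%N /\ exists eps' : E c'.+1, ext_free (adjs S s) eps'.
Proof.
elim: s c S eps => [|z s IH] c S eps epsF /=.
  by move=> _; exists c; rewrite addn0; split=> //; exists eps.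
move=> [zreg sreg]; have [eta [_ _ /IH[//|c' [-> h]]]] := ext_free_adj epsF zreg.
by exists (c.+1 + size s)%N; split; first by rewrite addSnnS.
Qed.

Section Local.
Variable m : idealr A.
Hypothesis mloc : local_ring m.
Local Notation M := (fun a => a \in m).
Variable n : nat.
Hypothesis Etop : forall i, (n < i)%N -> forall u : E i, u = 0.

(** The regular sequence is prolonged until the socle is nonzero; noetherian induction on S ends the
    process. *)
Lemma ext_free_max c S (eps : E c.+1) : ext_free S eps -> subideal S M ->
  exists k c' S' (eps' : E c'.+1), [/\ c' = (c + k)%N, ext_free S' eps', depth_ge M S k &
    exists2 u, ~ S' u & forall a, a \in m -> S' (a * u)].
Proof.
have mid := idealr_ideal m.
suff main T : ideal T -> forall c S (eps : E c.+1), S = T -> ext_free S eps -> subideal S M ->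
    exists k c' S' (eps' : E c'.+1), [/\ c' = (c + k)%N, ext_free S' eps', depth_ge M S k &
    exists2 u, ~ S' u & forall a, a \in m -> S' (a * u)].
  by move=> epsF; have [Sid _ _ _ _] := epsF; apply: (main S Sid c S eps erefl epsF).
move: T; apply: (noetherian_ind noethA) => T Tid IH {}c {}S {}eps ST epsF Sm.
have Sid : ideal S by case: epsF.
have [nosoc|[u Su um]] := no_socleP mid Sid; last first.
  by exists 0%N, c, S, eps; split; rewrite ?addn0 //; exists u.
have [|z mz zreg] := regular_avoidance noethA (N := 1) (J := fun=> S) mid.
  by [].
have {}zreg := zreg 0%N isT.
have [eta [_ _ etaF]] := ext_free_adj epsF zreg.
have nz : ~ T z.
  rewrite -ST => Sz; have S1 : S 1 by apply: zreg; rewrite mulr1.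
  by have := Sm _ S1; rewrite idealr1.
have TK : subideal T (adj S z) by rewrite -ST; apply: subideal_adj.
have [|k [c' [S' [eps' [cE epsF' dep soc]]]]] :=
    IH _ z (ideal_adj Sid z) TK (mem_adj Sid z) nz _ _ _ erefl etaF.
  exact: adj_min.
exists k.+1, c', S', eps'; split=> //; first by rewrite cE addSnnS.
by exists z.
Qed.

Lemma resolution_depth k : krull_dim A k -> exists t,
  [/\ depth_ge M (fun a => a = 0) t, (k <= t)%N &
    forall s z J a l, regulars (fun a => a = 0) s -> regular (adjs (fun a => a = 0) s) z ->
    ideal J -> (forall y, y \in s -> J y) -> depth_ge M J l -> (t <= size s + l)%N ->
    (forall j, J j -> adj (adjs (fun a => a = 0) s) z (a * j)) ->
    exists2 b, forall j, J j -> adjs (fun a => a = 0) s (b * j) &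
      adj (adjs (fun a => a = 0) s) z (a - b)].
Proof.
move=> [[p pchain] _].
have mP := local_prime noethA mloc; have mid := idealr_ideal m.
have [|t [c' [S' [eps' [+ epsF' dep [u Su um]]]]]] := ext_free_max ext_free0.
  by move=> a ->; apply: idealr0.
rewrite add0n => cE; subst c'.
have Sid : ideal S' by case: epsF'.
have vanish i J : (t < i)%N -> ideal J -> null M i J.
  move=> ti Jid; apply: (null_above_depth Etop epsF' mP (u := u) _ ti Jid) => a.
  split=> [/um//|au]; apply: contrapT => /negP/(local_unit noethA mloc)[b ba].
  by apply: Su; rewrite -[u]mul1r -ba -mulrA; apply: idealMl.
exists t; split=> //.
  apply: (prime_chain_bound (p := fun i a => a \in p i)).
  - by move=> i _; apply: prime_idealr_pred.
  - move=> i ik; have [sub [x px npx]] := pchain i ik; split; first by move=> a /sub.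
    by exists x => //; apply/negP.
  (* All primes of the chain lie in m, so a multiplier outside m is outside each of them. *)
  - move=> i J ti Jid w /(vanish i J ti Jid)[s /negP sm sB]; exists s => // sp.
    by case/negP: sm; apply: (idealr_sub_local noethA mloc) sp.
move=> s z J a l sreg zreg Jid sJ dep_J tl.
have [c' [cE [eps epsF]]] := ext_free_adjs ext_free0 sreg.
apply: (ext_free_colon epsF zreg Jid).
  by apply: adjs_min => // b ->; apply: ideal0.
apply: (null_ext0 (m := M)); first by move=> b /negP/(local_unit noethA mloc).
by apply: (null_depth_ge mP vanish Jid dep_J); rewrite cE add0n addSn ltnS.
Qed.

End Local.

End Resolution.

(* The last clause says (s, z) : K = (s : K) + (z), and comes from
   Ext^(c+1)(A/K, A) = 0 with c the length of s. *)
Lemma gorenstein_colon (A : comNzRingType) (m : idealr A) (k : nat) :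
  gorenstein_local m -> krull_dim A k -> exists t,
  [/\ depth_ge (fun a => a \in m) (fun a => a = 0) t, (k <= t)%N &
    forall s z J a l, regulars (fun a => a = 0) s -> regular (adjs (fun a => a = 0) s) z ->
    ideal J -> (forall y, y \in s -> J y) -> depth_ge (fun a => a \in m) J l ->
    (t <= size s + l)%N ->
    (forall j, J j -> adj (adjs (fun a => a = 0) s) z (a * j)) ->
    exists2 b, forall j, J j -> adjs (fun a => a = 0) s (b * j) &
      adj (adjs (fun a => a = 0) s) z (a - b)].
Proof.
move=> [noethA mloc [n [E [d [e [injE Etop einj ex0 ex]]]]]] hk.
(* [resolution_depth] wants the resolution shifted by one, starting with 0. *)
pose F i : lmodType A := if i is j.+1 then E j else 'rV[A]_0.
pose D i : {linear F i -> F i.+1} :=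
  match i return {linear F i -> F i.+1} with
  | 0 => \0 : {linear 'rV[A]_0 -> E 0}
  | j.+1 => d j
  end.
have eE a : e a = a *: e (1 : A^o) by rewrite -linearZ -[a *: _]/(a * 1) mulr1.
apply: (@resolution_depth A F D (e (1 : A^o)) noethA _ _ _ _ _ _ m mloc n.+1 _ k hk).
- case=> [|i]; last exact: injE.
  move=> M N i f iinj; exists (\0 : {linear N -> 'rV[A]_0}) => u.
  by apply/rowP; case.
- by move=> u; apply/rowP; case.
- case=> [|i] u; first exact: linear0.
  by apply/(ex i); exists u.
- by move=> i v /(ex i).
- move=> v; split=> [/ex0[a ->]|[a ->]]; first by exists a; rewrite eE.
  by apply/ex0; exists (a : A^o); apply/esym/eE.
- by move=> a; rewrite -eE -(linear0 e) => /einj.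
- by case=> [//|i] ni u; apply: Etop.
Qed.

(** * Construction of a regular sequence on H_1 *)

Section Construction.
Variables (A : comNzRingType) (m : idealr A) (I : idealr A) (x y : seq A) (t : nat).
Hypotheses (noethA : noetherian A) (mloc : local_ring m).
Local Notation M := (fun a : A => is_true (a \in m)).
Local Notation J := (fun a : A => is_true (a \in I)).
Local Notation zero := (fun a : A => a = 0).
Hypothesis colonP : forall s z K a l, regulars zero s -> regular (adjs zero s) z ->
  ideal K -> (forall b, b \in s -> K b) -> depth_ge M K l -> (t <= size s + l)%N ->
  (forall j, K j -> adj (adjs zero s) z (a * j)) ->
  exists2 b, forall j, K j -> adjs zero s (b * j) & adj (adjs zero s) z (a - b).
Hypotheses (depthA : depth_ge M zero t) (depthI : depth_ge M J (t - size y)).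
Hypotheses (xI : generates x I) (xsize : size x = (size y + 2)%N).
Hypotheses (yI : {subset y <= I}) (yreg : regulars zero y).

Let xE : J = idl x. Proof. by apply: pred_ext => a; apply: xI. Qed.
Let Iid : ideal J. Proof. exact: idealr_ideal. Qed.
Let mid : ideal M. Proof. exact: idealr_ideal. Qed.
Let zid : ideal zero. Proof. by split=> // a u v -> ->; rewrite mulr0 addr0. Qed.
Let ym a : a \in y -> a \in m.
Proof. by move/yI; apply: (idealr_sub_local noethA mloc). Qed.

(* Invariant of the construction of an H1-regular sequence: zs is regular on A
   and A/I and y stays regular modulo zs. *)
Let good (zs : seq A) : Prop :=
  [/\ {subset zs <= m}, regulars zero zs /\ regulars J zs,
      forall i, (i < size y)%N -> regular (adjs (adjs zero zs) (take i y)) y`_i,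
      forall i, (i <= size y)%N ->
        depth_ge M (adjs (adjs zero zs) (take i y)) (t - i - size zs) &
      depth_ge M (adjs J zs) (t - size y - size zs)].

Let good_nil : good [::].
Proof.
have yregi i : (i <= size y)%N -> regulars zero (take i y).
  by move=> iy; have := yreg; rewrite -{1}(cat_take_drop i y) => /regulars_cat[].
split=> //=.
- move=> i iy; have := yregi i.+1 iy; rewrite (take_nth 0) //.
  by case/regulars_rcons.
- move=> i iy; rewrite subn0 -{2}(size_takel iy); apply: depth_ge_adjs => //; last exact: yregi.
  by move=> a /mem_take/ym.
- by rewrite subn0.
Qed.

Lemma good_step zs : good zs -> (size zs < t - size y)%N -> exists z,
  good (rcons zs z) /\ forall c : koszul x 1,
    boundary_mod zs (z *: c) -> boundary_mod zs c.
Proof.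
move=> [zm [z0 zI] yz dyz dI] zt.
have Zid : ideal (adjs zero zs) := ideal_adjs zs zid.
have Yid i : ideal (adjs (adjs zero zs) (take i y)) := ideal_adjs _ Zid.
have JZid : ideal (adjs J zs) := ideal_adjs zs Iid.
(* The family consists of the [size y + 1] prefixes of y modulo zs, together with I + (zs). *)
have [|z mz zreg] := regular_avoidance noethA (N := (size y).+2)
    (J := fun i => if (i <= size y)%N then adjs (adjs zero zs) (take i y) else adjs J zs) mid.
  move=> i iN; case: ifP => iy; split=> //.
    have := dyz i iy; rewrite -[X in depth_ge _ _ X]prednK; last by lia.
    exact: depth_ge_no_socle.
  have := dI; rewrite -[X in depth_ge _ _ X]prednK; last by lia.
  exact: depth_ge_no_socle.
have zy i : (i <= size y)%N -> regular (adjs (adjs zero zs) (take i y)) z.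
  by move=> iy; have := zreg i; rewrite iy; apply; apply: leqW.
have zJ : regular (adjs J zs) z.
  by have := zreg (size y).+1; rewrite ltnn; apply.
have z1 : regular (adjs zero zs) z by have := zy 0%N isT; rewrite take0.
have yz' i : (i < size y)%N -> regular (adj (adjs (adjs zero zs) (take i y)) z) y`_i.
  move=> iy; apply: regular_swap => //; [exact: yz | exact/zy/ltnW |].
  by rewrite -adjs_rcons -take_nth //; apply: zy.
exists z; split; last first.
  move=> c; apply: boundary_mod_regular; rewrite idl_adjs //.
  have zy_reg : regulars zero (zs ++ y).
    by apply/regulars_cat; split=> //; apply: regulars_nth.
  have zyE : adjs zero (zs ++ y) = adjs (adjs zero zs) y by rewrite /adjs foldl_cat.
  apply: (liftable_seq (ys := y)) => //.
    move=> s y0 r yE.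
    have sy : (size s < size y)%N by rewrite yE size_cat /=; lia.
    have sE : take (size s) y = s by rewrite yE take_size_cat.
    have y0E : y`_(size s) = y0 by rewrite yE nth_cat ltnn subnn.
    split.
    - by have := yz _ sy; rewrite sE y0E.
    - by have := yz' _ sy; rewrite sE y0E.
    - have /xI[f fE] : y0 \in I by apply: yI; rewrite yE mem_cat mem_head orbT.
      by exists f; rewrite fE; apply: eq_bigr => i _; apply: mulrC.
  (* Here 2 + [size y] is the number of generators: lifting in degree 2 is reduced to the top
     degree. *)
  rewrite addnC -xsize -[foldl _ _ _]/(adjs _ y) -zyE.
  have Sid : ideal (adjs zero (zs ++ y)) := ideal_adjs _ zid.
  have Szid := ideal_adj Sid z.
  apply: liftable_top => // a ax.
  (* The ideal must contain the whole sequence zs ++ y, hence I + (zs) in place of I. *)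
  have [|b|||b bJ ab] := colonP (s := zs ++ y) (z := z) (K := adjs J zs) (a := a)
      (l := (t - size y - size zs)%N) zy_reg _ JZid _ dI.
  - by rewrite zyE -(take_size y); apply: zy.
  - rewrite mem_cat => /orP[bz|b_y]; first exact: mem_adjs.
    by apply: subideal_adjs => //; apply: yI.
  - by rewrite size_cat; lia.
  - suff sub : subideal (adjs J zs) (colon (adj (adjs zero (zs ++ y)) z) a).
      by move=> j /sub; rewrite /colon mulrC.
    apply: adjs_min (ideal_colon Szid a) _ _ => [|b bz].
      rewrite xE; apply: idl_min (ideal_colon Szid a) _ => b /(nthP 0)[i ix <-].
      by rewrite /colon mulrC; apply: (ax (Ordinal ix)).
    apply/(idealM Szid)/subideal_adj/mem_adjs => //.
    by rewrite mem_cat bz.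
  exists b => // j; apply: bJ; apply: subideal_adjs => //.
  by apply/xI; apply: mem_idl; apply: mem_nth.
split.
- by move=> a; rewrite mem_rcons inE => /predU1P[->|/zm].
- by split; apply/regulars_rcons.
- by move=> i iy; rewrite adjs_rcons adjs_adj //; apply: yz'.
- move=> i iy; rewrite adjs_rcons adjs_adj // size_rcons.
  apply: depth_ge_regular => //; last exact: zy.
  by apply: depth_geW (dyz i iy); lia.
- rewrite adjs_rcons size_rcons; apply: depth_ge_regular => //.
  by apply: depth_geW dI; lia.
Qed.

Lemma good_regular_sequence k : (k <= t - size y)%N -> exists2 zs, size zs = k &
  good zs /\ forall i (u : koszul_H1 x), (i < size zs)%N ->
    in_span (take i zs) (zs`_i *: u) -> in_span (take i zs) u.
Proof.
elim: k => [|k IH] kt; first by exists [::].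
have [zs sz [zsG zsH]] := IH (ltnW kt).
have [|z [zG zH]] := good_step zsG; first by rewrite sz.
exists (rcons zs z); first by rewrite size_rcons sz.
split=> // i u; rewrite size_rcons ltnS leq_eqVlt nth_rcons -cats1.
case/predU1P=> [->|iz]; last by rewrite iz takel_cat ?(ltnW iz) //; apply: zsH.
rewrite ltnn eqxx take_size_cat // -[u]reprK pi_scale => /H1_span_boundary.
rewrite cycle_valZ => /zH; have [_ [z0 zI] _ _ _] := zsG.
by apply: boundary_H1_span; rewrite // -xE.
Qed.

Lemma koszul_H1_depth : depth_at_least m (koszul_H1 x) (t - size y).
Proof.
have [zs sz [[zm _ _ _ _] zH]] := good_regular_sequence (leqnn _).
(* If zs spans H_1, then H_1 = 0 and its grade is infinite; otherwise zs extends to a maximal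
   regular sequence. *)
have [spanned|/existsNP[u nu]] := pselect (forall u : koszul_H1 x, in_span zs u).
  left=> u; exists [::]; first by [].
  rewrite (H1_spanned_eq0 noethA (local_prime noethA mloc) _ zm spanned u).
    exact: submod0 (submod_span _ _).
  by move=> a /negP/(local_unit noethA mloc).
right; have [|s' s'max ss'] := regular_sequence_extend noethA (M := koszul_H1 x) (s := zs) zm.
  by split=> //; exists u.
by exists (size s'); [exists s' | rewrite -sz].
Qed.

End Construction.

(** * The depth of A/I and the final bound *)

Theorem theorem1p13 (A : comNzRingType) (m : idealr A) (d : nat)
    (I : idealr A) (g mu : nat) (x : seq A)
    (hA : gorenstein_local m)
    (hd : krull_dim A d)
    (hg : has_grade I (A^o)%R g)
    (hmu : min_num_generators I mu)
    (hgmu : mu = (g + 2)%N)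
    (hCM : cohen_macaulay_local {ideal_quot I})
    (hx : generates x I)
    (hxmu : size x = mu) :
  depth_at_least m (koszul_H1 x) (d - g - 2)%N.
Proof.
have [noethA mloc _] := hA; have mid := idealr_ideal m; have Iid := idealr_ideal I.
have mU a : ~ a \in m -> exists b, b * a = 1 by move=> /negP/(local_unit noethA mloc).
have [t [depthA dt colonP]] := gorenstein_colon hA hd.
have [y [yI yseq ymax] yg] := hg.
have yreg := regular_sequence_regulars yseq.
have ym a : a \in y -> a \in m by move/yI; apply: (idealr_sub_local noethA mloc).
have depthI : depth_ge (fun a => a \in m) (fun a => a \in I) (t - size y).
  have [n [_ nloc [e hdim [s [sn sreg _] se]]]] := hCM.
  apply: (@depth_geW _ _ _ e).
    have yid := ideal_span y.
    (* Without such a u, I would contain an element regular modulo y, against maximality. So I kills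
       a nonzero u modulo (y), and depth A/(y) bounds the dimension of A/I from below. *)
    have [nosoc|[u yu Iu]] := no_socleP Iid yid.
      have [|z zI zreg] := regular_avoidance noethA (N := 1) (J := fun=> idl y) Iid.
        by [].
      case: (ymax z zI); split.
        move=> i u; rewrite size_rcons ltnS leq_eqVlt nth_rcons -cats1.
        case/predU1P=> [->|iy]; last by rewrite iy takel_cat ?(ltnW iy) //; apply: yseq.1.
        by rewrite ltnn eqxx take_size_cat //; apply: (zreg 0%N).
      exists (1 : A^o) => h; have : (1 : A) \in I.
        apply: (idl_min Iid _ h) => a; rewrite mem_rcons inE => /predU1P[->//|]; exact: yI.
      by rewrite idealr1.
    have depth_y : depth_ge (fun a => a \in m) (idl y) (t - size y).
      rewrite idl_adjs; apply: depth_ge_adjs => //.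
      by split=> // a b c -> ->; rewrite mulr0 addr0.
    have Im : subideal (fun a => a \in I) (fun a => a \in m).
      by move=> a; apply: (idealr_sub_local noethA mloc).
    have [p [pP Ip pS]] := depth_prime_chain noethA (local_prime noethA mloc) yid depth_y
      Iid Im yu mU Iu.
    exact: krull_dim_quot_ge hdim pP Ip pS.
  rewrite -se -(size_map (@repr _ {ideal_quot I}) s); apply: regulars_depth_ge.
    move=> a /mapP[z zs ->]; apply: contrapT => /mU[b]; apply: quot_idealr_lift.
    exact: sn zs.
  exact: regular_sequence_quot.
have H : depth_at_least m (koszul_H1 x) (t - size y).
  have xs : size x = (size y + 2)%N by rewrite hxmu hgmu yg.
  exact: (koszul_H1_depth noethA mloc colonP depthA depthI hx xs yI yreg).
case: H => [h|[n hn nt]]; [by left | right; exists n => //].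
(* From d <= t, the depth t - g is at least d - g - 2. *)
by apply: leq_trans nt; rewrite yg; lia.
Qed.
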